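(* Let $A$ be an integrally closed domain with quotient field $K$, let $a,b\in A$ be nonzero elements, and let $B=A[a/b]\subseteq K$. Let $R=A[X]$ be the polynomial ring, let $\pi:R\rightarrow B$ be the $A$-algebra morphism sending $X$ to $a/b$, let $I=\ker\pi$, and identify $B$ with $R/I$. Then there are isomorphisms of $R$-modules $$(i)\quad \Omega_{B/A}\cong \frac{B}{(bA:_Aa)B}\cong \frac{abA}{(aA+bA)(aA\cap bA)}\otimes_A R,$$ $$(ii)\quad H_1(A,B,B)\cong \frac{a^2A\cap b^2A}{(aA\cap bA)^2}\otimes_A R.$$
   Context: All rings are commutative with unit. For a ring morphism $A\to B$ and a $B$-module $E$, $H_n(A,B,E)$ denotes the $n$-th André-Quillen homology module; in particular $H_0(A,B,B)=\Omega_{B/A}$, the module of Kähler differentials. $bA:_Aa=\{x\in A\mid xa\in bA\}$. $B$-modules are regarded as $R$-modules via $\pi$. *)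

(* Defs.v *)
From HB Require Import structures.
From mathcomp Require Import all_boot all_algebra.
From mathcomp Require Import boolp classical_sets.
From mathcomp Require Import finmap monalg.

Set Implicit Arguments.
Unset Strict Implicit.
Unset Printing Implicit Defensive.

Import GRing.Theory.
Import Quotient.

Local Open Scope classical_set_scope.
Local Open Scope ring_scope.
Local Open Scope quotient_scope.

Identity Coercion fun_of_set : set >-> Funclass.

(** * Submodules, quotients, restriction of scalars *)

Record submodule (R : nzRingType) (V : lmodType R) := Submodule {
  submodule_set :> set V;
  submodule_closed : submodule_set 0 /\
    forall (c : R) (u v : V),
      submodule_set u -> submodule_set v -> submodule_set (c *: u + v)
}.

Section Submodules.
Variables (R : nzRingType) (V : lmodType R).

Definition submodule_pred (W : submodule V) : {pred V} := fun v => `[< W v >].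

Lemma submodule_predP (W : submodule V) v :
  reflect (W v) (v \in submodule_pred W).
Proof. exact: asboolP. Qed.

Fact submodule_pred_closed W : submod_closed (submodule_pred W).
Proof.
have [W0 WD] := submodule_closed W.
split=> [|c u v /submodule_predP Wu /submodule_predP Wv];
  by apply/submodule_predP; auto.
Qed.
HB.instance Definition _ W :=
  GRing.isSubmodClosed.Build R V (submodule_pred W) (submodule_pred_closed W).

Definition submodule_type (W : submodule V) := {v : V | v \in submodule_pred W}.
HB.instance Definition _ W := SubChoice.on (submodule_type W).
HB.instance Definition _ W :=
  [SubChoice_isSubLmodule of submodule_type W by <:].

Definition quotmod (W : submodule V) := Quotient.quot (submodule_pred W).
HB.instance Definition _ W := GRing.Zmodule.on (quotmod W).

Section QuotScale.
Variable W : submodule V.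

Definition qpi (v : V) : quotmod W := \pi v.
Definition quotmod_scale (c : R) (q : quotmod W) : quotmod W :=
  qpi (c *: repr q).

Lemma qpi_eq u v : W (u - v) -> qpi u = qpi v.
Proof.
move=> Wuv; apply/eqP; rewrite /qpi -Quotient.idealrBE.
exact/submodule_predP.
Qed.

Lemma qpi_eqP u v : qpi u = qpi v <-> W (u - v).
Proof.
split=> [/eqP|]; last exact: qpi_eq.
by rewrite /qpi -Quotient.idealrBE => /submodule_predP.
Qed.

Lemma qpiK (q : quotmod W) : qpi (repr q) = q. Proof. exact: reprK. Qed.

Lemma quotmod_scaleE c v : quotmod_scale c (qpi v) = qpi (c *: v).
Proof.
apply: qpi_eq; rewrite -scalerBr -[_ *: _]addr0.
have [W0 WD] := submodule_closed W.
by apply: WD => //; apply/qpi_eqP; rewrite qpiK.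
Qed.

Lemma qpiD u v : qpi (u + v) = qpi u + qpi v.
Proof. by rewrite /qpi !piE. Qed.

Fact quotmod_scaleA c d q :
  quotmod_scale c (quotmod_scale d q) = quotmod_scale (c * d) q.
Proof. by rewrite -[q]qpiK !quotmod_scaleE scalerA. Qed.
Fact quotmod_scale1 : left_id 1 quotmod_scale.
Proof. by move=> q; rewrite -[q]qpiK !quotmod_scaleE scale1r. Qed.
Fact quotmod_scaleDr : right_distributive quotmod_scale +%R.
Proof.
move=> c p q; rewrite -[p]qpiK -[q]qpiK -qpiD !quotmod_scaleE.
by rewrite -qpiD scalerDr.
Qed.
Fact quotmod_scaleDl q : {morph quotmod_scale^~ q : c d / c + d}.
Proof. by move=> c d; rewrite -[q]qpiK !quotmod_scaleE -qpiD scalerDl. Qed.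
HB.instance Definition _ := GRing.Zmodule_isLmodule.Build R (quotmod W)
  quotmod_scaleA quotmod_scale1 quotmod_scaleDr quotmod_scaleDl.

Fact qpi_is_linear : linear qpi.
Proof. by move=> c u v; rewrite qpiD -quotmod_scaleE. Qed.
HB.instance Definition _ := GRing.isLinear.Build R V (quotmod W) _ qpi
  qpi_is_linear.

End QuotScale.

Fact spanmod_closed (S : set V) :
  let sp := fun v => forall W : submodule V, S `<=` W -> W v in
  sp 0 /\ forall (c : R) u v, sp u -> sp v -> sp (c *: u + v).
Proof.
split=> [W _|c u v spu spv W SW]; first by case: (submodule_closed W).
by have [_ WD] := submodule_closed W; apply: WD; [apply: spu|apply: spv].
Qed.
Definition spanmod (S : set V) : submodule V := Submodule (spanmod_closed S).

Lemma sub_spanmod (S : set V) : S `<=` spanmod S.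
Proof. by move=> v Sv W; apply. Qed.

Fact cap_closed (U W : submodule V) :
  (U `&` W) 0 /\ forall (c : R) u v,
    (U `&` W) u -> (U `&` W) v -> (U `&` W) (c *: u + v).
Proof.
have [[U0 UD] [W0 WD]] := (submodule_closed U, submodule_closed W).
by split=> // c u v [] Uu Wu [] Uv Wv; split; auto.
Qed.
Definition cap_submodule (U W : submodule V) : submodule V :=
  Submodule (cap_closed U W).

Fact add_closed (U W : submodule V) :
  let S := [set x + y | x in U & y in W] in
  S 0 /\ forall (c : R) u v, S u -> S v -> S (c *: u + v).
Proof.
have [[U0 UD] [W0 WD]] := (submodule_closed U, submodule_closed W).
split=> [|c _ _ [u Uu [w Ww <-]] [u' Uu' [w' Ww' <-]]].
  by exists 0 => //; exists 0; rewrite ?addr0.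
exists (c *: u + u'); first exact: UD.
by exists (c *: w + w'); [exact: WD | rewrite scalerDr addrACA].
Qed.
Definition add_submodule (U W : submodule V) : submodule V :=
  Submodule (add_closed U W).

End Submodules.

Section LinearSubmodules.
Variables (R : nzRingType) (V V' : lmodType R) (f : {linear V -> V'}).

Fact preim_closed (W : submodule V') :
  (f @^-1` W) 0 /\ forall (c : R) u v,
    (f @^-1` W) u -> (f @^-1` W) v -> (f @^-1` W) (c *: u + v).
Proof.
have [W0 WD] := submodule_closed W.
by split=> [|c u v]; rewrite /preimage /= ?linear0 // linearP; auto.
Qed.
Definition preim_submodule W : submodule V := Submodule (preim_closed W).

Fact ker_closed :
  (f @^-1` [set 0]) 0 /\ forall (c : R) u v, (f @^-1` [set 0]) u ->
    (f @^-1` [set 0]) v -> (f @^-1` [set 0]) (c *: u + v).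
Proof.
split=> [|c u v]; rewrite /preimage /= ?linear0 // linearP => -> ->.
by rewrite scaler0 addr0.
Qed.
Definition ker_submodule : submodule V := Submodule ker_closed.

Fact im_closed :
  range f 0 /\ forall (c : R) u v, range f u -> range f v ->
    range f (c *: u + v).
Proof.
split=> [|c _ _ [u _ <-] [v _ <-]]; first by exists 0; rewrite ?linear0.
by exists (c *: u + v); rewrite ?linearP.
Qed.
Definition im_submodule : submodule V' := Submodule im_closed.

End LinearSubmodules.

(** [subquot M N] is [M / (M :&: N)]; it is only used when [N] is contained
    in [M]. *)
Definition subquot (R : nzRingType) (V : lmodType R) (M N : submodule V)
    : lmodType R :=
  quotmod (preim_submodule (\val : submodule_type M -> V) N).

Definition restr (R S : nzRingType) (f : {rmorphism R -> S})
  (V : lmodType S) : Type := V.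

Section Restr.
Variables (R S : nzRingType) (f : {rmorphism R -> S}) (V : lmodType S).

HB.instance Definition _ := GRing.Zmodule.on (restr f V).

Definition restr_scale (c : R) (v : restr f V) : restr f V :=
  f c *: (v : V).
Fact restr_scaleA c d v :
  restr_scale c (restr_scale d v) = restr_scale (c * d) v.
Proof. by rewrite /restr_scale scalerA rmorphM. Qed.
Fact restr_scale1 : left_id 1 restr_scale.
Proof. by move=> v; rewrite /restr_scale rmorph1 scale1r. Qed.
Fact restr_scaleDr : right_distributive restr_scale +%R.
Proof. by move=> c u v; rewrite /restr_scale scalerDr. Qed.
Fact restr_scaleDl v : {morph restr_scale^~ v : c d / c + d}.
Proof. by move=> c d; rewrite /restr_scale rmorphD scalerDl. Qed.
HB.instance Definition _ := GRing.Zmodule_isLmodule.Build R (restr f V)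
  restr_scaleA restr_scale1 restr_scaleDr restr_scaleDl.
End Restr.

Definition isomorphic (R : nzRingType) (V W : lmodType R) : Prop :=
  exists f : {linear V -> W}, bijective f.

(** * Linear maps out of free modules and out of quotients *)

Section FreeLift.
Variables (R : nzRingType) (K : choiceType) (V : lmodType R) (h : K -> V).

Definition free_lift (x : {malg R[K]}) : V := \sum_(k <- msupp x) x@_k *: h k.

Lemma free_liftEw (d : {fset K}) (x : {malg R[K]}) :
  {subset msupp x <= d} -> free_lift x = \sum_(k <- d) x@_k *: h k.
Proof.
move=> /fsubsetP xd; rewrite /free_lift (big_fset_incl _ xd) // => k _ kx.
by rewrite (mcoeff_outdom kx) scale0r.
Qed.

Fact free_lift_is_linear : linear free_lift.
Proof.
move=> c x y; pose d := (msupp x `|` msupp y)%fset.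
have xd : {subset msupp x <= d} by apply/fsubsetP/fsubsetUl.
have yd : {subset msupp y <= d} by apply/fsubsetP/fsubsetUr.
have zd : {subset msupp (c *: x + y) <= d}.
  apply/fsubsetP; apply: (fsubset_trans (msuppD_le _ _)).
  exact/fsetSU/msuppZ_le.
rewrite (free_liftEw xd) (free_liftEw yd) (free_liftEw zd).
rewrite scaler_sumr -big_split /=; apply: eq_bigr => k _.
by rewrite mcoeffD mcoeffZ scalerDl scalerA.
Qed.
HB.instance Definition _ := GRing.isLinear.Build R {malg R[K]} V _ free_lift
  free_lift_is_linear.

Lemma free_liftU k : free_lift (mkmalgU k 1) = h k.
Proof.
rewrite (@free_liftEw [fset k]%fset); last exact/fsubsetP/msuppU_le.
by rewrite big_seq_fset1 mcoeffUU scale1r.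
Qed.
End FreeLift.

Section QuotLift.
Variables (R : nzRingType) (V V' : lmodType R) (S : set V).
Variables (f : {linear V -> V'}) (fS : forall v, S v -> f v = 0).

Definition quot_lift_fun (q : quotmod (spanmod S)) : V' := f (repr q).

Fact quot_lift_funE v : quot_lift_fun (qpi (spanmod S) v) = f v.
Proof.
apply/eqP; rewrite /quot_lift_fun -subr_eq0 -linearB; apply/eqP.
have /qpi_eqP/(_ (ker_submodule f)) :
    qpi (spanmod S) (repr (qpi (spanmod S) v)) = qpi (spanmod S) v.
  by rewrite qpiK.
by apply.
Qed.

Fact quot_lift_is_linear : linear quot_lift_fun.
Proof.
move=> c p q; rewrite -[p]qpiK -[q]qpiK -linearP !quot_lift_funE.
exact: linearP.
Qed.
Definition quot_lift : {linear quotmod (spanmod S) -> V'} :=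
  HB.pack quot_lift_fun (GRing.isLinear.Build R (quotmod (spanmod S)) V' _
    quot_lift_fun quot_lift_is_linear).

Lemma quot_liftE v : quot_lift (qpi (spanmod S) v) = f v.
Proof. exact: quot_lift_funE. Qed.
End QuotLift.
Arguments quot_lift : simpl never.

(** * Ideals *)

Definition ideal (A : comNzRingType) := submodule A^o.

Section Ideals.
Variable A : comNzRingType.

Fact principal_closed (c : A) :
  let S : set A^o := [set c * x | x in [set: A]] in
  S 0 /\ forall (r : A) (u v : A^o), S u -> S v -> S (r *: u + v).
Proof.
split=> [|r _ _ [u _ <-] [v _ <-]]; first by exists 0; rewrite ?mulr0.
by exists (r * u + v) => //; rewrite mulrDr mulrCA.
Qed.
Definition principal (c : A) : ideal A := Submodule (principal_closed c).

Definition mul_ideal (I J : ideal A) : ideal A :=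
  @spanmod A A^o [set (x : A) * y | x in I & y in J].

Fact colon_closed (I : ideal A) (c : A) :
  let S : set A^o := [set x : A | I (x * c)] in
  S 0 /\ forall (r : A) (u v : A^o), S u -> S v -> S (r *: u + v).
Proof.
have [I0 ID] := submodule_closed I; split=> [|r u v Iu Iv] /=.
  by rewrite mul0r.
by have := ID r _ _ Iu Iv; rewrite /= mulrDl -mulrA.
Qed.
Definition colon (I : ideal A) (c : A) : ideal A :=
  Submodule (colon_closed I c).
End Ideals.

Definition extend_ideal (A B : comNzRingType) (f : {rmorphism A -> B})
  (I : ideal A) : ideal B := @spanmod B B^o [set f x | x in I].

(** * Kaehler differentials and base change *)

Section Kahler.
Variables (A B : comNzRingType) (f : {rmorphism A -> B}).

Local Notation "'δ' b" := (mkmalgU b 1 : {malg B[B]}) (at level 10).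

Definition kahler_rel : set {malg B[B]} :=
  [set x | (exists b c : B, x = δ (b + c)%R - δ b - δ c) \/
           (exists b c : B, x = δ (b * c)%R - b *: δ c - c *: δ b) \/
           (exists a : A, x = δ (f a))].

Definition kahler : lmodType B := quotmod (spanmod kahler_rel).
Definition kahler_d (b : B) : kahler := qpi (spanmod kahler_rel) (δ b).
End Kahler.

(** For [f : A -> S], an [A]-module [M] and an [S]-module [E], [tensor f M E]
    is the [S]-module obtained from [M ⊗_A E], where [S] acts through [E]: the
    fourth family of relations identifies [c * (m ⊗ e)] with [m ⊗ (c * e)]. *)
Section Tensor.
Variables (A S : comNzRingType) (f : {rmorphism A -> S}).
Variables (M : lmodType A) (E : lmodType S).

Local Notation "m ⊠ e" := (mkmalgU (m, e) 1 : {malg S[(M * E)%type]})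
  (at level 40).

Definition tensor_rel : set {malg S[(M * E)%type]} :=
  [set x |
    (exists (m m' : M) (e : E), x = (m + m')%R ⊠ e - m ⊠ e - m' ⊠ e) \/
    (exists (m : M) (e e' : E), x = m ⊠ (e + e')%R - m ⊠ e - m ⊠ e') \/
    (exists (r : A) (m : M) (e : E), x = (r *: m)%R ⊠ e - m ⊠ (f r *: e)%R) \/
    (exists (c : S) (m : M) (e : E), x = c *: (m ⊠ e) - m ⊠ (c *: e)%R)].

Definition tensor : lmodType S := quotmod (spanmod tensor_rel).
Definition tens (m : M) (e : E) : tensor := qpi (spanmod tensor_rel) (m ⊠ e).

Lemma tensDl m m' e : tens (m + m') e = tens m e + tens m' e.
Proof.
rewrite /tens -linearD; apply/qpi_eq/sub_spanmod; left; exists m, m', e.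
by rewrite opprD addrA.
Qed.
Lemma tensDr m e e' : tens m (e + e') = tens m e + tens m e'.
Proof.
rewrite /tens -linearD; apply/qpi_eq/sub_spanmod; right; left; exists m, e, e'.
by rewrite opprD addrA.
Qed.
Lemma tensZ r m e : tens (r *: m) e = tens m (f r *: e).
Proof.
by apply/qpi_eq/sub_spanmod; do 2!right; left; exists r, m, e.
Qed.
Lemma tensZr c m e : tens m (c *: e) = c *: tens m e.
Proof.
rewrite /tens -linearZ; apply/esym/qpi_eq/sub_spanmod; do 3!right.
by exists c, m, e.
Qed.
End Tensor.

Section KahlerTheory.
Variables (A B : comNzRingType) (f : {rmorphism A -> B}).

Lemma kahler_dD b c : kahler_d f (b + c) = kahler_d f b + kahler_d f c.
Proof.
rewrite /kahler_d -linearD; apply/qpi_eq/sub_spanmod; left; exists b, c.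
by rewrite opprD addrA.
Qed.
Lemma kahler_dM b c :
  kahler_d f (b * c) = b *: kahler_d f c + c *: kahler_d f b.
Proof.
rewrite /kahler_d -!linearZ -linearD; apply/qpi_eq/sub_spanmod; right; left.
by exists b, c; rewrite opprD addrA.
Qed.
Lemma kahler_d_base a : kahler_d f (f a) = 0.
Proof.
rewrite /kahler_d -(linear0 (qpi (spanmod (kahler_rel f)))).
by apply/qpi_eq/sub_spanmod; do 2!right; exists a; rewrite subr0.
Qed.
End KahlerTheory.

Fact addKK (V : zmodType) (x y : V) : x + y - x - y = 0.
Proof. by rewrite -addrA -opprD subrr. Qed.

Lemma malgU_scale (R : nzRingType) (K : choiceType) (k : K) (c : R) :
  mkmalgU k c = c *: mkmalgU k 1 :> {malg R[K]}.
Proof. by apply/malgP => l; rewrite mcoeffZ !mcoeffU mulrnAr mulr1. Qed.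

Lemma kahler_ext (A B : comNzRingType) (f : {rmorphism A -> B})
    (W : lmodType B) (u v : {linear kahler f -> W}) :
  (forall b, u (kahler_d f b) = v (kahler_d f b)) -> u =1 v.
Proof.
move=> uv q; rewrite -[q]qpiK; set x := repr q.
rewrite [x]monalgE !linear_sum; apply: eq_bigr => b _.
by rewrite malgU_scale !linearZ; congr (_ *: _); apply: uv.
Qed.

Lemma tensor_ext (A S : comNzRingType) (f : {rmorphism A -> S})
    (M : lmodType A) (E W : lmodType S) (u v : {linear tensor f M E -> W}) :
  (forall m e, u (tens f m e) = v (tens f m e)) -> u =1 v.
Proof.
move=> uv q; rewrite -[q]qpiK; set x := repr q.
rewrite [x]monalgE !linear_sum; apply: eq_bigr => -[m e] _.
by rewrite malgU_scale !linearZ; congr (_ *: _); apply: uv.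
Qed.

Section KahlerMap.
Variables (A B B' : comNzRingType).
Variables (f : {rmorphism A -> B}) (f' : {rmorphism A -> B'}).
Variables (g : {rmorphism B -> B'}) (gf : forall a, g (f a) = f' a).

Definition kahler_map_gen (b : B) : restr g (kahler f') := kahler_d f' (g b).

Fact kahler_map_rel x : kahler_rel f x -> free_lift kahler_map_gen x = 0.
Proof.
case=> [[b [c ->]]|[[b [c ->]]|[a ->]]].
- rewrite 2!linearB /= !free_liftU /kahler_map_gen rmorphD kahler_dD.
  exact: addKK.
- rewrite 2!linearB /= !linearZ /= !scalerN !free_liftU.
  rewrite {1}/kahler_map_gen rmorphM.
  have -> : kahler_d f' (g b * g c) =
      b *: kahler_map_gen c + c *: kahler_map_gen b by exact: kahler_dM.
  exact: addKK.
- by rewrite free_liftU /kahler_map_gen gf kahler_d_base.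
Qed.

Definition kahler_map : {linear kahler f -> restr g (kahler f')} :=
  quot_lift kahler_map_rel.

Lemma kahler_map_d b : kahler_map (kahler_d f b) = kahler_d f' (g b).
Proof. by rewrite /kahler_map /kahler_d quot_liftE /= free_liftU. Qed.
End KahlerMap.
Arguments kahler_map : simpl never.

Section TensorMap.
Variables (A A' S : comNzRingType) (g : {rmorphism A -> A'}).
Variables (f : {rmorphism A -> S}) (f' : {rmorphism A' -> S}).
Hypothesis f'g : forall a, f' (g a) = f a.
Variables (M : lmodType A) (M' : lmodType A') (E : lmodType S).
Variable theta : {linear M -> restr g M'}.

Definition tensor_map_gen (z : M * E) : tensor f' M' E :=
  tens f' (theta z.1 : M') z.2.

Fact tensor_map_rel x : tensor_rel f x -> free_lift tensor_map_gen x = 0.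
Proof.
case=> [[m [m' [e ->]]]|[[m [e [e' ->]]]|[[r [m [e ->]]]|[c [m [e ->]]]]]];
  rewrite ?linearB /= ?linearB ?linearZ /= ?free_liftU /tensor_map_gen /=.
- by rewrite linearD tensDl; exact: addKK.
- by rewrite tensDr; exact: addKK.
- by rewrite linearZ /= tensZ f'g subrr.
- by rewrite tensZr subrr.
Qed.

Definition tensor_map : {linear tensor f M E -> tensor f' M' E} :=
  quot_lift tensor_map_rel.

Lemma tensor_mapE m e : tensor_map (tens f m e) = tens f' (theta m : M') e.
Proof. by rewrite /tensor_map /tens quot_liftE /= free_liftU. Qed.
End TensorMap.
Arguments tensor_map : simpl never.

(** * Algebras and polynomial algebras *)

Record algebra (A : comNzRingType) := Algebra {
  algebra_ring :> comNzRingType;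
  algebra_map : {rmorphism A -> algebra_ring}
}.

Record algebra_hom (A : comNzRingType) (C D : algebra A) := AlgebraHom {
  algebra_fun :> {rmorphism C -> D};
  algebra_funE : forall a, algebra_fun (algebra_map C a) = algebra_map D a
}.

Section PolynomialAlgebras.
Variable A : comNzRingType.

(** [A[X_i : i in I]] *)
Definition poly_algebra (I : choiceType) : algebra A :=
  @Algebra A {malg A[{cmonom I}]} (@malgC {cmonom I} A).

Definition poly_var (I : choiceType) (i : I) : poly_algebra I :=
  mkmalgU (ucm i) 1.

Section Eval.
Variables (I : choiceType) (D : algebra A) (h : I -> D).

Definition monom_eval (m : {cmonom I}) : D := \prod_(i <- finsupp m) h i ^+ m i.

Lemma monom_evalEw (d : {fset I}) (m : {cmonom I}) :
  {subset finsupp m <= d} -> monom_eval m = \prod_(i <- d) h i ^+ m i.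
Proof.
move=> /fsubsetP md; rewrite /monom_eval (big_fset_incl _ md) // => i _.
by rewrite -cmE_eq0 => /eqP ->; rewrite expr0.
Qed.

Fact monom_eval_morphism : mmorphism monom_eval.
Proof.
split=> [m n|]; last by rewrite /monom_eval mdom1 big_seq_fset0.
have md : {subset finsupp m <= finsupp (mmul m n)}.
  by apply/fsubsetP; rewrite mdomD fsubsetUl.
have nd : {subset finsupp n <= finsupp (mmul m n)}.
  by apply/fsubsetP; rewrite mdomD fsubsetUr.
rewrite (monom_evalEw md) (monom_evalEw nd) -big_split /=.
by apply: eq_bigr => i _; rewrite cmM exprD.
Qed.
HB.instance Definition _ := isMultiplicative.Build {cmonom I} D monom_eval
  monom_eval_morphism.

Definition poly_eval_fun : {rmorphism poly_algebra I -> D} :=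
  mmap (algebra_map D) monom_eval.

Fact poly_eval_funE a :
  poly_eval_fun (algebra_map (poly_algebra I) a) = algebra_map D a.
Proof. exact: mmapC. Qed.
End Eval.
End PolynomialAlgebras.

(** The [A]-algebra morphism mapping [X_i] to [h i]; it is locked because
    conversion would otherwise unfold iterated polynomial evaluations. *)
HB.lock Definition poly_eval (A : comNzRingType) (I : choiceType)
    (D : algebra A) (h : I -> D) : algebra_hom (poly_algebra A I) D :=
  AlgebraHom (poly_eval_funE h).
Canonical poly_eval_unlockable := Unlockable poly_eval.unlock.
Arguments poly_eval {A I D} h.

Section PolynomialAlgebraTheory.
Variable A : comNzRingType.

Lemma poly_evalE (I : choiceType) (D : algebra A) (h : I -> D) p :
  poly_eval h p = mmap (algebra_map D) (monom_eval h) p.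
Proof. by rewrite unlock. Qed.

Lemma poly_eval_var (I : choiceType) (D : algebra A) (h : I -> D) i :
  poly_eval h (poly_var A i) = h i.
Proof.
rewrite poly_evalE mmapU [X in X * _](rmorph1 (algebra_map D)) mul1r.
by rewrite /monom_eval mdomU big_seq_fset1 cmUU expr1.
Qed.

Lemma hom_poly_eval (I : choiceType) (C D : algebra A) (u : algebra_hom C D)
    (h : I -> C) p :
  u (poly_eval h p) = poly_eval (u \o h) p.
Proof.
rewrite !poly_evalE /mmap rmorph_sum; apply: eq_bigr => m _.
rewrite rmorphM /= algebra_funE rmorph_prod; congr (_ * _).
by apply: eq_bigr => i _; rewrite rmorphXn.
Qed.

Definition id_hom (C : algebra A) : algebra_hom C C :=
  @AlgebraHom A C C idfun (fun=> erefl).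

Fact comp_homE (C D F : algebra A) (v : algebra_hom D F)
    (u : algebra_hom C D) a :
  (v \o u) (algebra_map C a) = algebra_map F a.
Proof. by rewrite /= !algebra_funE. Qed.
Definition comp_hom (C D F : algebra A) (v : algebra_hom D F)
    (u : algebra_hom C D) : algebra_hom C F :=
  @AlgebraHom A C F (v \o u) (comp_homE v u).

Definition counit (C : algebra A) : algebra_hom (poly_algebra A C) C :=
  poly_eval id.

Definition poly_map (C D : algebra A) (u : C -> D) :
    algebra_hom (poly_algebra A C) (poly_algebra A D) :=
  poly_eval (fun c => poly_var A (u c)).

Lemma eq_poly_eval (I : choiceType) (C : algebra A) (h h' : I -> C) p :
  h =1 h' -> poly_eval h p = poly_eval h' p.
Proof. by move=> /funext ->. Qed.

Lemma counit_natural (C D : algebra A) (u : algebra_hom C D) p :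
  counit D (poly_map u p) = u (counit C p).
Proof.
rewrite /counit /poly_map !hom_poly_eval.
apply: eq_poly_eval => c; exact: poly_eval_var.
Qed.

Lemma poly_map_comp (C D F : algebra A) (v : D -> F) (u : C -> D) p :
  poly_map v (poly_map u p) = poly_map (v \o u) p.
Proof.
rewrite /poly_map hom_poly_eval.
by apply: eq_poly_eval => c; apply: poly_eval_var.
Qed.

End PolynomialAlgebraTheory.

(** * Homology of augmented simplicial algebras *)

(** The complex below only involves the face operators of a simplicial algebra,
    so the degeneracies are left out. [face n i] is meaningful for
    [i <= n.+1]. *)
Record semisimplicial_algebra (A : comNzRingType) (B : algebra A) :=
  SemisimplicialAlgebra {
    simplices :> nat -> algebra A;
    face : forall n, nat -> algebra_hom (simplices n.+1) (simplices n);
    augmentation : forall n, algebra_hom (simplices n) B;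
    face_face : forall n i j p, (i <= j <= n.+1)%N ->
      face n i (face n.+1 j.+1 p) = face n j (face n.+1 i p);
    augmentation_face : forall n i p,
      augmentation n (face n i p) = augmentation n.+1 p
  }.

Section AlternatingSum.
Variables (R : comNzRingType) (U V : lmodType R) (d : nat -> {linear U -> V}).

Definition alternating_sum_fun (n : nat) (x : U) : V :=
  \sum_(i < n) (-1) ^+ i *: d i x.

Fact alternating_sum_is_linear n : linear (alternating_sum_fun n).
Proof.
move=> c x y; rewrite /alternating_sum_fun scaler_sumr -big_split /=.
by apply: eq_bigr => i _; rewrite linearP scalerDr !scalerA mulrC.
Qed.
HB.instance Definition _ n := GRing.isLinear.Build R U V _
  (alternating_sum_fun n) (alternating_sum_is_linear n).

Definition alternating_sum (n : nat) : {linear U -> V} :=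
  alternating_sum_fun n.
End AlternatingSum.

Lemma alternating_sum_alternating_sum (R : comNzRingType) (U V W : lmodType R)
  (d : nat -> {linear U -> V}) (e : nat -> {linear V -> W}) n :
  (forall i j x, (i <= j)%N -> (j < n)%N -> e i (d j.+1 x) = e j (d i x)) ->
  forall x, alternating_sum e n (alternating_sum d n.+1 x) = 0.
Proof.
move=> H x; rewrite /alternating_sum /= /alternating_sum_fun.
under eq_bigr => i _ do rewrite linear_sum /= scaler_sumr.
under eq_bigr => i _ do
  (under eq_bigr => j _ do rewrite linearZ scalerA -exprD).
pose F (i j : nat) := (-1) ^+ (i + j) *: e i (d j x) : W.
rewrite -[LHS]/(\sum_(i < n) \sum_(j < n.+1) F i j).
have -> : \sum_(i < n) \sum_(j < n.+1) F i j =
    \sum_(i < n) \sum_(j < n.+1 | (j <= i)%N) F i j +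
    \sum_(i < n) \sum_(j < n.+1 | ~~ (j <= i)%N) F i j.
  rewrite -big_split; apply: eq_bigr => i _.
  by rewrite (bigID (fun j : 'I_n.+1 => (j <= i)%N)).
apply/eqP; rewrite addr_eq0; apply/eqP; rewrite -sumrN.
have E (i : 'I_n) : \sum_(j < n.+1 | ~~ (j <= i)%N) F i j =
    \sum_(j < n | (i <= j)%N) F i j.+1.
  rewrite big_mkcond big_ord_recl /= add0r [RHS]big_mkcond /=.
  by apply: eq_bigr => j _; rewrite /bump add1n -ltnNge ltnS.
under [RHS]eq_bigr => i _ do rewrite E -sumrN.
rewrite [RHS](exchange_big_dep xpredT) //=; apply: eq_bigr => i _.
rewrite big_mkcond big_ord_recr /= leqNgt ltn_ord /= addr0 -big_mkcond /=.
apply: eq_bigr => j ji; rewrite /F H // ?ltn_ord // addnS exprS mulN1r addnC.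
by rewrite scaleNr opprK.
Qed.

(** Functoriality of [Ω_(C/A) ⊗_C E] in the augmented algebra [C], for two
    composites [C0 -> C1 -> C2] that agree. *)
Section KahlerTensorSquare.
Variables (A C0 C1 C2 S : comNzRingType).
Variables (a0 : {rmorphism A -> C0}) (a1 : {rmorphism A -> C1}).
Variables (a2 : {rmorphism A -> C2}).
Variables (e0 : {rmorphism C0 -> S}) (e1 : {rmorphism C1 -> S}).
Variables (e2 : {rmorphism C2 -> S}) (E : lmodType S).
Variables (g h : {rmorphism C0 -> C1}) (g' h' : {rmorphism C1 -> C2}).
Hypothesis ga : forall x, g (a0 x) = a1 x.
Hypothesis ha : forall x, h (a0 x) = a1 x.
Hypothesis g'a : forall x, g' (a1 x) = a2 x.
Hypothesis h'a : forall x, h' (a1 x) = a2 x.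
Hypothesis ge : forall x, e1 (g x) = e0 x.
Hypothesis he : forall x, e1 (h x) = e0 x.
Hypothesis g'e : forall x, e2 (g' x) = e1 x.
Hypothesis h'e : forall x, e2 (h' x) = e1 x.
Hypothesis gh : forall x, g' (g x) = h' (h x).

Let gg : {rmorphism C0 -> C2} := g' \o g.
Let u (m : kahler a0) : restr gg (kahler a2) :=
  kahler_map g'a (kahler_map ga m : kahler a1).
Let v (m : kahler a0) : restr gg (kahler a2) :=
  kahler_map h'a (kahler_map ha m : kahler a1).

Fact kahler_square_linear1 : linear u.
Proof.
move=> c y z; rewrite /u (linearP (kahler_map ga)).
exact: (linearP (kahler_map g'a)).
Qed.

Fact kahler_square_linear2 : linear v.
Proof.
move=> c y z; rewrite /v (linearP (kahler_map ha)).
rewrite [LHS](linearP (kahler_map h'a)); congr (_ + _).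
by congr (_ *: (_ : kahler a2)); rewrite /= gh.
Qed.

Lemma kahler_square m :
  kahler_map g'a (kahler_map ga m : kahler a1) =
  kahler_map h'a (kahler_map ha m : kahler a1) :> kahler a2.
Proof.
pose u1 : {linear _ -> _} :=
  HB.pack u (GRing.isLinear.Build _ _ _ _ u kahler_square_linear1).
pose v1 : {linear _ -> _} :=
  HB.pack v (GRing.isLinear.Build _ _ _ _ v kahler_square_linear2).
apply: (@kahler_ext _ _ _ _ u1 v1) => c.
by rewrite /= /u /v !kahler_map_d gh.
Qed.

Lemma kahler_tensor_square x :
  tensor_map g'e E (kahler_map g'a) (tensor_map ge E (kahler_map ga) x) =
  tensor_map h'e E (kahler_map h'a) (tensor_map he E (kahler_map ha) x).
Proof.
pose s := tensor_map g'e E (kahler_map g'a) \o tensor_map ge E (kahler_map ga).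
pose t := tensor_map h'e E (kahler_map h'a) \o tensor_map he E (kahler_map ha).
apply: (@tensor_ext _ _ _ _ _ _ s t) => m e.
transitivity (tens e2 (kahler_map g'a (kahler_map ga m : kahler a1)) e).
  rewrite -(tensor_mapE g'e (kahler_map g'a)).
  by rewrite -(tensor_mapE ge (kahler_map ga)).
rewrite kahler_square -(tensor_mapE h'e (kahler_map h'a)).
by rewrite -(tensor_mapE he (kahler_map ha)).
Qed.
End KahlerTensorSquare.

Section SemisimplicialHomology.
Variables (A : comNzRingType) (B : algebra A) (P : semisimplicial_algebra B).
Variable E : lmodType B.

(** [Ω_(P_n/A) ⊗_(P_n) E], with [P_n] acting on [E] through the augmentation *)
Definition kahler_complex (n : nat) : lmodType B :=
  tensor (augmentation P n) (kahler (algebra_map (P n))) E.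

Definition kahler_face (n i : nat) :
    {linear kahler_complex n.+1 -> kahler_complex n} :=
  tensor_map (@augmentation_face A B P n i)
    E (kahler_map (algebra_funE (face P n i))).

Definition boundary (n : nat) :
    {linear kahler_complex n.+1 -> kahler_complex n} :=
  alternating_sum (kahler_face n) n.+2.

Lemma boundary_boundary n x : boundary n (boundary n.+1 x) = 0.
Proof.
apply: alternating_sum_alternating_sum => i j y ij jn.
by apply: kahler_tensor_square => z; apply: face_face; rewrite ij -ltnS.
Qed.

Definition homology (n : nat) : lmodType B :=
  match n with
  | 0 => quotmod (im_submodule (boundary 0))
  | m.+1 => subquot (ker_submodule (boundary m)) (im_submodule (boundary m.+1))
  end.

End SemisimplicialHomology.

(** * The standard simplicial resolution and Andre-Quillen homology *)

Section Standard.
Variables (A : comNzRingType) (B : algebra A).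

(** [tower n] is [A[A[...[B]...]]], with [n] nested polynomial algebras. *)
Fixpoint tower (n : nat) : algebra A :=
  if n is m.+1 then poly_algebra A (tower m) else B.

(** [tower_face n i : tower n.+1 -> tower n], meaningful for [i <= n], applies
    the counit at the [i]-th nested level. *)
Fixpoint tower_face (n i : nat) : algebra_hom (tower n.+1) (tower n) :=
  match n, i with
  | m.+1, j.+1 => poly_map (tower_face m j)
  | k, _ => counit (tower k)
  end.

Fixpoint tower_aug (n : nat) : algebra_hom (tower n) B :=
  if n is m.+1 then comp_hom (tower_aug m) (counit (tower m)) else id_hom B.

Lemma tower_face0 n : tower_face n 0 = counit (tower n).
Proof. by case: n. Qed.

Lemma tower_faceS n i : tower_face n.+1 i.+1 = poly_map (tower_face n i).
Proof. exact: erefl. Qed.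

Lemma tower_augS n p : tower_aug n.+1 p = tower_aug n (counit (tower n) p).
Proof. exact: erefl. Qed.

Fact tower_aug_face n i p :
  tower_aug n (tower_face n i p) = tower_aug n.+1 p.
Proof.
elim: n i p => [|n IHn] i p; first by case: i.
case: i => [|i]; first by rewrite tower_face0.
by rewrite tower_augS tower_faceS counit_natural IHn tower_augS.
Qed.

Fact tower_face_face n i j p : (i <= j <= n)%N ->
  tower_face n i (tower_face n.+1 j.+1 p) =
  tower_face n j (tower_face n.+1 i p).
Proof.
elim: n i j p => [|n IHn] i j p /andP[].
  case: j => [|j]; last by rewrite ltn0.
  case: i => [|i]; last by rewrite ltn0.
  move=> _ _; exact: (counit_natural (tower_face 0 0)).
case: i => [|i].
  by move=> _ _; rewrite !tower_face0 tower_faceS counit_natural.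
case: j => [|j]; first by move=> ij; exfalso; rewrite ltn0 in ij.
move=> ij jn.
have E : (tower_face n i \o tower_face n.+1 j.+1 : _ -> _) =
    tower_face n j \o tower_face n.+1 i.
  by apply/funext => c; apply: (IHn i j c); apply/andP.
refine (etrans (poly_map_comp (tower_face n i) (tower_face n.+1 j.+1) p) _).
rewrite E.
exact: (esym (poly_map_comp (tower_face n j) (tower_face n.+1 i) p)).
Qed.

(** The standard resolution: [P_n] is [tower n.+1]. *)
Definition standard : semisimplicial_algebra B := {|
  simplices n := tower n.+1;
  face n := tower_face n.+1;
  augmentation n := tower_aug n.+1;
  face_face n := @tower_face_face n.+1;
  augmentation_face n := @tower_aug_face n.+1
|}.

End Standard.

(** [H_n(A, B, E)] *)
Definition andre_quillen (A B : comNzRingType) (f : {rmorphism A -> B})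
  (E : lmodType B) (n : nat) : lmodType B :=
  homology (standard (Algebra f)) E n.

(** * The ring [A[a/b]] *)

Section Adjoin.
Variable A : idomainType.

Definition integrally_closed : Prop :=
  forall x : {fraction A}, integralOver (@tofrac A) x ->
    exists c : A, x = tofrac c.

Variables a b : A.

Definition adjoin_pred : {pred {fraction A}} := fun y =>
  `[< exists p : {poly A},
      y = (map_poly (@tofrac A) p).[tofrac a / tofrac b] >].

Lemma adjoin_predP y :
  reflect (exists p : {poly A},
    y = (map_poly (@tofrac A) p).[tofrac a / tofrac b])
    (y \in adjoin_pred).
Proof. exact: asboolP. Qed.

Fact adjoin_closed : subring_closed adjoin_pred.
Proof.
split.
- by apply/adjoin_predP; exists 1; rewrite rmorph1 hornerC.
- move=> _ _ /adjoin_predP[p ->] /adjoin_predP[q ->]; apply/adjoin_predP.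
  by exists (p - q); rewrite rmorphB !hornerE.
- move=> _ _ /adjoin_predP[p ->] /adjoin_predP[q ->]; apply/adjoin_predP.
  by exists (p * q); rewrite rmorphM hornerM.
Qed.
HB.instance Definition _ := GRing.isSubringClosed.Build {fraction A} adjoin_pred
  adjoin_closed.

(** [A[a/b]], as a subring of the fraction field of [A] *)
Definition adjoin := {y : {fraction A} | y \in adjoin_pred}.
HB.instance Definition _ := SubChoice.on adjoin.
HB.instance Definition _ := [SubChoice_isSubComNzRing of adjoin by <:].

Fact adjoin_eval_in (p : {poly A}) :
  (map_poly (@tofrac A) p).[tofrac a / tofrac b] \in adjoin_pred.
Proof. by apply/adjoin_predP; exists p. Qed.

Definition adjoin_eval_fun (p : {poly A}) : adjoin :=
  exist (fun y => y \in adjoin_pred) _ (adjoin_eval_in p).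

Fact adjoin_eval_zmod : zmod_morphism adjoin_eval_fun.
Proof. by move=> p q; apply: val_inj; rewrite /= rmorphB !hornerE. Qed.
Fact adjoin_eval_monoid : monoid_morphism adjoin_eval_fun.
Proof.
split=> [|p q]; apply: val_inj; rewrite /=.
  by rewrite rmorph1 hornerC.
by rewrite rmorphM hornerM.
Qed.
HB.instance Definition _ := GRing.isZmodMorphism.Build {poly A} adjoin
  adjoin_eval_fun adjoin_eval_zmod.
HB.instance Definition _ := GRing.isMonoidMorphism.Build {poly A} adjoin
  adjoin_eval_fun adjoin_eval_monoid.

(** The [A]-algebra morphism [A[X] -> A[a/b]] mapping [X] to [a/b]. *)
Definition adjoin_eval : {rmorphism {poly A} -> adjoin} := adjoin_eval_fun.

Definition adjoin_map : {rmorphism A -> adjoin} := adjoin_eval \o polyC.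

End Adjoin.

(* Main.v *)
Require Import Defs.
From mathcomp Require Import all_boot all_algebra.
From HB Require Import structures.
From mathcomp Require Import boolp classical_sets.
From mathcomp Require Import finmap monalg ring.
Import GRing.Theory.
Local Open Scope ring_scope.

Set Implicit Arguments.
Unset Strict Implicit.
Unset Printing Implicit Defensive.

(** Put x = a/b, R = A[X], I = ker pi and J = (bA : a). If p in I has leading
    coefficient c, then c x is integral over A, so that c X - c x is in I; by
    descent on the degree, I consists of the polynomials (X - x) q with q in
    J[X]. Hence the derivatives of elements of I generate J B, which gives
    Ω = B / J B, and the latter is R / (I + J R) = A/(J + x J) ⊗ R.

    For H_1, the standard resolution starts with A[B] <- A[A[B]] <- A[A[A[B]]].
    Lifting B to R by a section s with s x = X yields sigma : A[B] -> R, and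
    X |-> X_x yields tau : R -> A[B]. The difference of the two faces
    A[A[B]] -> A[B], followed by sigma, is a derivation into I/I^2, and
    f |-> [tau f] - [0] is its inverse on homology, because tau sigma is
    homotopic to the identity. So H_1 is the kernel N/I^2 of I/I^2 -> B dX,
    where N consists of the f with f(x) = f'(x) = 0. Using the description of I
    twice, N consists of the (X - x)^2 g where all coefficients c of g satisfy
    c x^2 in A, i.e. a^2 c in a^2A :&: b^2A, while I^2 corresponds to
    a^2 c in (aA :&: bA)^2. *)

(** * Modules, subquotients, linear maps out of tensor products *)

Section Modules.
Variable R : nzRingType.
Implicit Types V W U : lmodType R.

(** Two values of [P] at one vector differ by a value at [0], so the last condition makes [P] a
    graph. Maps between subquotients are built this way from representatives, and only the fibre
    over [0] has to be inspected. *)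
Lemma linear_of_rel V W (P : V -> W -> Prop) :
  (forall c u v u' v', P u u' -> P v v' -> P (c *: u + v) (c *: u' + v')) ->
  (forall v, exists w, P v w) -> (forall w, P 0 w -> w = 0) ->
  exists f : {linear V -> W}, forall v w, P v w <-> f v = w.
Proof.
move=> Plin /choice[f Pf] P0w.
have fP v w : P v w -> f v = w.
  move=> Pvw; apply/eqP; rewrite -subr_eq0; apply/eqP/P0w.
  by have := Plin (-1) _ _ _ _ Pvw (Pf v); rewrite !scaleN1r addNr addrC.
have f_lin : linear f by move=> c u v; apply: fP; apply: Plin.
exists (HB.pack f (GRing.isLinear.Build R V W _ f f_lin) : {linear V -> W}).
by move=> v w; split=> [/fP|<-] //=.
Qed.

Lemma isomorphic_of_bij V W (f : {linear V -> W}) :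
  (forall w, exists v, f v = w) -> (forall v, f v = 0 -> v = 0) ->
  isomorphic V W.
Proof.
move=> /choice[g gK] f_inj; exists f, g => // v.
by apply/eqP; rewrite -subr_eq0; apply/eqP/f_inj; rewrite linearB gK subrr.
Qed.

Lemma isomorphic_of_rel V W (P : V -> W -> Prop) :
  (forall c u v u' v', P u u' -> P v v' -> P (c *: u + v) (c *: u' + v')) ->
  (forall v, exists w, P v w) -> (forall w, exists v, P v w) ->
  (forall w, P 0 w -> w = 0) -> (forall v, P v 0 -> v = 0) ->
  isomorphic V W.
Proof.
move=> Plin Pl Pr P0w Pv0; have [f fP] := linear_of_rel Plin Pl P0w.
apply: (@isomorphic_of_bij _ _ f) => [w|v /fP/Pv0 //].
by have [v /fP] := Pr w; exists v.
Qed.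

Lemma isomorphic_trans U V W :
  isomorphic U V -> isomorphic V W -> isomorphic U W.
Proof.
move=> [f f_bij] [g g_bij]; exists (g \o f : {linear _ -> _}).
exact: bij_comp.
Qed.

Section Subquot.
Variables (V : lmodType R) (M N : submodule V).

Definition in_submodule (v : V) : submodule_type M := insubd 0 v.

Lemma val_in_submodule v : M v -> \val (in_submodule v) = v.
Proof. by move=> Mv; rewrite insubdK //; apply/submodule_predP. Qed.

(** The class of [v] in [M / N] if [v] lies in [M], and [0] otherwise. *)
Definition subq (v : V) : subquot M N := qpi _ (in_submodule v).

Lemma subq_surj q : exists2 v, M v & q = subq v.
Proof.
rewrite -[q]qpiK; set m := repr q.
have Mm : M (\val m) by apply/submodule_predP/(valP m).
by exists (\val m) => //; congr qpi; apply: val_inj; rewrite val_in_submodule.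
Qed.

Lemma subqP c u v : M u -> M v -> subq (c *: u + v) = c *: subq u + subq v.
Proof.
move=> Mu Mv; rewrite /subq -linearP; congr qpi; apply: val_inj.
rewrite linearP /= !val_in_submodule //.
by have [_] := submodule_closed M; apply.
Qed.

Lemma subqD u v : M u -> M v -> subq (u + v) = subq u + subq v.
Proof. by move=> Mu Mv; have := subqP 1 Mu Mv; rewrite !scale1r. Qed.

Lemma subq_eq0 v : M v -> subq v = 0 <-> N v.
Proof.
move=> Mv; rewrite -[0](linear0 (qpi _)) (qpi_eqP _ (in_submodule v) 0) subr0.
by rewrite /= /preimage /= val_in_submodule.
Qed.

Lemma subqZ c u : M u -> subq (c *: u) = c *: subq u.
Proof.
have [[M0 _] [N0 _]] := (submodule_closed M, submodule_closed N).
move=> Mu; have := subqP c Mu M0.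
by have /(subq_eq0 M0) -> := N0; rewrite !addr0.
Qed.

Lemma subqB u v : M u -> M v -> subq (u - v) = subq u - subq v.
Proof.
by move=> Mu Mv; rewrite -[- v]scaleN1r addrC subqP // scaleN1r addrC.
Qed.
End Subquot.

Lemma submodule0 V (W : submodule V) : W 0.
Proof. by case: (submodule_closed W). Qed.
Lemma submoduleP V (W : submodule V) c u v : W u -> W v -> W (c *: u + v).
Proof. by case: (submodule_closed W) => _; apply. Qed.
Lemma submoduleD V (W : submodule V) u v : W u -> W v -> W (u + v).
Proof. by rewrite -[u in W (u + v)]scale1r; apply: submoduleP. Qed.
Lemma submoduleZ V (W : submodule V) c u : W u -> W (c *: u).
Proof.
move=> Wu; rewrite -[_ *: _]addr0; apply: submoduleP => //; exact: submodule0.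
Qed.
Lemma submoduleN V (W : submodule V) u : W u -> W (- u).
Proof. by rewrite -scaleN1r; apply: submoduleZ. Qed.
Lemma submodule_sum V (W : submodule V) (I : Type) (r : seq I) (p : pred I)
    (F : I -> V) :
  (forall i, p i -> W (F i)) -> W (\sum_(i <- r | p i) F i).
Proof.
move=> WF; apply: big_ind => //; [exact: submodule0 | exact: submoduleD].
Qed.

Lemma spanmod_min V (S : classical_sets.set V) (W : submodule V) v :
  (forall u, S u -> W u) -> spanmod S v -> W v.
Proof. by move=> SW; apply. Qed.
End Modules.

(** The projection modulo [W] and the zero map agree on all differentials, hence everywhere. *)
Lemma kahler_ind (A B : comNzRingType) (f : {rmorphism A -> B})
    (W : submodule (kahler f)) :
  (forall b, W (kahler_d f b)) -> forall q, W q.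
Proof.
move=> Wd q; rewrite -[q]subr0; apply/qpi_eqP; rewrite linear0.
apply: (@kahler_ext _ _ _ _ (qpi W) \0) => b /=.
by rewrite -(linear0 (qpi W)); apply/qpi_eqP; rewrite subr0.
Qed.

Lemma tensor_ind (A S : comNzRingType) (f : {rmorphism A -> S})
    (M : lmodType A) (E : lmodType S) (W : submodule (tensor f M E)) :
  (forall m e, W (tens f m e)) -> forall q, W q.
Proof.
move=> Wt q; rewrite -[q]subr0; apply/qpi_eqP; rewrite linear0.
apply: (@tensor_ext _ _ _ _ _ _ (qpi W) \0) => m e /=.
by rewrite -(linear0 (qpi W)); apply/qpi_eqP; rewrite subr0.
Qed.

Lemma kahler_lift (A B : comNzRingType) (f : {rmorphism A -> B})
    (W : lmodType B) (D : B -> W) :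
  {morph D : b c / b + c} -> (forall b c, D (b * c) = b *: D c + c *: D b) ->
  (forall a, D (f a) = 0) ->
  exists L : {linear kahler f -> W}, forall b, L (kahler_d f b) = D b.
Proof.
move=> DD DM Df.
have rel0 x : kahler_rel f x -> free_lift D x = 0.
  case=> [[b [c ->]]|[[b [c ->]]|[a ->]]].
  - by rewrite 2!linearB /= !free_liftU DD; exact: addKK.
  - rewrite 2!linearB /= !linearZ /= !scalerN !free_liftU DM; exact: addKK.
  - by rewrite free_liftU Df.
by exists (quot_lift rel0) => b; rewrite quot_liftE /= free_liftU.
Qed.

Lemma tensor_lift (A S : comNzRingType) (f : {rmorphism A -> S})
    (M : lmodType A) (E W : lmodType S) (h : M -> E -> W) :
  (forall m m' e, h (m + m') e = h m e + h m' e) ->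
  (forall m e e', h m (e + e') = h m e + h m e') ->
  (forall r m e, h (r *: m) e = h m (f r *: e)) ->
  (forall c m e, h m (c *: e) = c *: h m e) ->
  exists L : {linear tensor f M E -> W}, forall m e, L (tens f m e) = h m e.
Proof.
move=> hDl hDr hZ hZr; pose g (z : M * E) := h z.1 z.2.
have rel0 x : tensor_rel f x -> free_lift g x = 0.
  case=> [[m [m' [e ->]]]|[[m [e [e' ->]]]|[[r [m [e ->]]]|[c [m [e ->]]]]]];
    rewrite ?linearB /= ?linearB ?linearZ /= ?free_liftU /g /=.
  - by rewrite hDl; exact: addKK.
  - by rewrite hDr; exact: addKK.
  - by rewrite hZ subrr.
  - by rewrite hZr subrr.
by exists (quot_lift rel0) => m e; rewrite quot_liftE /= free_liftU.
Qed.

(** A derivation over [e] is a derivation into [restr e W], so it factors through the differentials;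
    extending scalars then gives [L]. The maps out of chain modules constructed below come from
    this. *)
Lemma kahler_tensor_lift (A C S : comNzRingType) (i : {rmorphism A -> C})
    (e : {rmorphism C -> S}) (W : lmodType S) (D : C -> W) :
  {morph D : x y / x + y} ->
  (forall x y, D (x * y) = e x *: D y + e y *: D x) ->
  (forall a, D (i a) = 0) ->
  exists L : {linear tensor e (kahler i) S^o -> W},
    forall x c, L (tens e (kahler_d i x) c) = c *: D x.
Proof.
move=> DD DM Di.
have [L LE] := @kahler_lift _ _ i (restr e W) D DD DM Di.
have LZ r m : L (r *: m) = e r *: (L m : W) :> W by rewrite linearZ.
have [||||T TE] := @tensor_lift _ _ e (kahler i) S^o W
    (fun m c => (c : S) *: (L m : W)).
- by move=> m m' c; rewrite linearD scalerDr.
- by move=> m c c'; rewrite scalerDl.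
- by move=> r m c; rewrite LZ scalerA mulrC.
- by move=> c m c'; rewrite scalerA.
by exists T => x c; rewrite TE LE.
Qed.

(** * Tensor products with [A[X]] *)

Section PolyTensor.
Variables (A : comNzRingType) (M : lmodType A).
Local Notation C := (polyC : {rmorphism A -> {poly A}}).
Local Notation T := (tensor C M {poly A}^o).

Definition X_sum (V : lmodType {poly A}) (h : M -> V) n (m : nat -> M) : V :=
  \sum_(k < n) 'X^k *: h (m k).

(** Stability under constants and under ['X], which shifts the coefficients, suffices by induction
    on the polynomial scalar. *)
Lemma X_sum_closed (V : lmodType {poly A}) (h : M -> V) :
  {morph h : m m' / m + m'} -> (forall a m, h (a *: m) = a%:P *: h m) ->
  let P v := exists n m, v = X_sum h n m in
  P 0 /\ forall (c : {poly A}) u v, P u -> P v -> P (c *: u + v).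
Proof.
move=> hD hZ P.
have h0 : h 0 = 0 by apply: (addrI (h 0)); rewrite -hD !addr0.
(* Sums are padded with zero coefficients so that two of them can be added termwise. *)
have widen n N (m : nat -> M) : (n <= N)%N ->
    X_sum h n m = X_sum h N (fun k => if (k < n)%N then m k else 0).
  move=> nN; rewrite /X_sum (big_ord_widen _ (fun k => 'X^k *: h (m k)) nN).
  rewrite big_mkcond; apply: eq_bigr => k _.
  by case: ifP; rewrite // h0 scaler0.
have PD t1 t2 : P t1 -> P t2 -> P (t1 + t2).
  move=> [n [m ->]] [n' [m' ->]].
  rewrite (widen n _ m (leq_addr n' n)) (widen n' _ m' (leq_addl n n')).
  exists (n + n')%N, (fun k => (if (k < n)%N then m k else 0) +
    (if (k < n')%N then m' k else 0)).
  rewrite /X_sum -big_split /=.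
  by apply: eq_bigr => k _; rewrite hD scalerDr.
have PC a t1 : P t1 -> P (a%:P *: t1).
  move=> [n [m ->]]; exists n, (fun k => a *: m k); rewrite /X_sum scaler_sumr.
  by apply: eq_bigr => k _; rewrite hZ !scalerA mulrC.
have PX t1 : P t1 -> P ('X *: t1).
  move=> [n [m ->]]; exists n.+1, (fun k => if k is k'.+1 then m k' else 0).
  rewrite /X_sum big_ord_recl /= h0 scaler0 add0r scaler_sumr.
  by apply: eq_bigr => k _; rewrite scalerA -exprS.
have PZ (c : {poly A}) t1 : P t1 -> P (c *: t1).
  move=> Pt; elim/poly_ind: c => [|c a IHc].
    by rewrite scale0r; exists 0%N, (fun=> 0); rewrite /X_sum big_ord0.
  by rewrite scalerDl mulrC -scalerA; apply: PD; [apply: PX|apply: PC].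
have P0 : P 0 by exists 0%N, (fun=> 0); rewrite /X_sum big_ord0.
by split=> // c u v Pu Pv; apply: PD => //; apply: PZ.
Qed.

Lemma X_sum_tens (t : T) :
  exists n m, t = X_sum (fun m : M => tens C m (1 : {poly A}^o)) n m.
Proof.
pose h (m : M) := tens C m (1 : {poly A}^o).
have hD : {morph h : m m' / m + m'} by move=> m m'; exact: tensDl.
have hZ a m : h (a *: m) = a%:P *: h m by rewrite /h tensZ tensZr.
apply: (tensor_ind (W := Submodule (X_sum_closed hD hZ))) => m e.
rewrite -[e]mulr1 tensZr; apply: submoduleZ.
exists 1%N, (fun=> m); rewrite /X_sum big_ord_recl big_ord0 addr0 expr0.
by rewrite scale1r.
Qed.

(** The hypotheses identify [W] with [M[X]]. By [X_sum_tens] tensors are sums of the same shape, and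
    the map [L] induced by [h] matches coefficients; its graph is read backwards, from [W] to the
    tensor product. *)
Lemma isomorphic_tensor_poly (W : lmodType {poly A})
    (h : {linear M -> restr C W}) :
  (forall w, exists n m, w = X_sum (h : M -> W) n m) ->
  (forall n m, X_sum (h : M -> W) n m = 0 ->
    forall k, (k < n)%N -> m k = 0) ->
  isomorphic W T.
Proof.
move=> h_surj h_inj.
have hZ r m : h (r *: m) = r%:P *: (h m : W) :> W by rewrite linearZ.
have [||||L LE] := @tensor_lift _ _ C M {poly A}^o W
    (fun m e => (e : {poly A}) *: (h m : W)).
- by move=> m m' e; rewrite linearD scalerDr.
- by move=> m e e'; rewrite scalerDl.
- by move=> r m e; rewrite hZ scalerA mulrC.
- by move=> c m e; rewrite scalerA.
have LX n m : L (X_sum (fun m : M => tens C m (1 : {poly A}^o)) n m) =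
    X_sum (h : M -> W) n m.
  rewrite /X_sum linear_sum; apply: eq_bigr => k _.
  by rewrite linearZ LE scale1r.
apply: (isomorphic_of_rel (P := fun w t => L t = w)).
- by move=> c u v u' v' <- <-; rewrite linearP.
- move=> w; have [n [m ->]] := h_surj w; exact: ex_intro (LX n m).
- by move=> t; exists (L t).
- move=> t; have [n [m ->]] := X_sum_tens t; rewrite LX => /h_inj m0.
  rewrite /X_sum big1 // => k _; rewrite m0 //.
  have -> : tens C (0 : M) (1 : {poly A}^o) = 0; last by rewrite scaler0.
  by apply: (addrI (tens C 0 1)); rewrite -tensDl !addr0.
- by move=> w <-; rewrite linear0.
Qed.
End PolyTensor.

(** An [R]-module [V] killed by the kernel of a surjection [pi : R -> S] is an
    [S]-module, [c : S] acting as any lift [s c]. *)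
Section Descent.
Variables (R S : comNzRingType) (pi : {rmorphism R -> S}) (s : S -> R).
Variables (V : lmodType R).

Definition descent (sK : cancel s pi)
  (V0 : forall r (v : V), pi r = 0 -> r *: v = 0) : Type := V.

Variables (sK : cancel s pi) (V0 : forall r (v : V), pi r = 0 -> r *: v = 0).
Local Notation D := (descent sK V0).

HB.instance Definition _ := GRing.Zmodule.on D.

Lemma descent_congr r r' (v : V) : pi r = pi r' -> r *: v = r' *: v.
Proof.
move=> rr'; apply/eqP; rewrite -subr_eq0 -scalerBl; apply/eqP/V0.
by rewrite rmorphB rr' subrr.
Qed.

Definition descent_scale (c : S) (v : D) : D := s c *: (v : V).
Fact descent_scaleA c d v :
  descent_scale c (descent_scale d v) = descent_scale (c * d) v.
Proof.
by rewrite /descent_scale scalerA; apply: descent_congr; rewrite rmorphM !sK.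
Qed.
Fact descent_scale1 : left_id 1 descent_scale.
Proof.
move=> v; rewrite -[RHS](scale1r (v : V)).
by apply: descent_congr; rewrite sK rmorph1.
Qed.
Fact descent_scaleDr : right_distributive descent_scale +%R.
Proof. by move=> c u v; rewrite /descent_scale scalerDr. Qed.
Fact descent_scaleDl v : {morph descent_scale^~ v : c d / c + d}.
Proof.
move=> c d; rewrite /descent_scale -scalerDl.
by apply: descent_congr; rewrite rmorphD !sK.
Qed.
HB.instance Definition _ := GRing.Zmodule_isLmodule.Build S D
  descent_scaleA descent_scale1 descent_scaleDr descent_scaleDl.

Lemma descentE r (v : V) : pi r *: (v : D) = r *: v.
Proof. by apply: descent_congr; rewrite sK. Qed.
End Descent.

(** * Differentials of polynomial algebras, conormal module *)

(** Monomials are treated by induction on the total degree, splitting off one variable; a polynomial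
    is a sum of constants times monomials. *)
Lemma poly_algebra_ind (A : comNzRingType) (I : choiceType)
    (P : poly_algebra A I -> Prop) :
  (forall a, P (algebra_map (poly_algebra A I) a)) ->
  (forall i, P (poly_var A i)) ->
  (forall p q, P p -> P q -> P (p + q)) ->
  (forall p q, P p -> P q -> P (p * q)) -> forall p, P p.
Proof.
move=> PC PX PD PM p.
have P0 : P 0 by rewrite -(rmorph0 (algebra_map (poly_algebra A I))).
have PU (m : {cmonom I}) : P (mkmalgU m 1).
  have [n] := ubnP (mdeg m); elim: n => // n IHn in m *; rewrite ltnS => m_n.
  have [/mdeg_eq0I ->|m_gt0] := posnP (mdeg m); first exact: PC.
  have [i im] : exists i, i \in finsupp m.
    apply/fset0Pn; apply: contraTneq m_gt0 => m0.
    by rewrite mdegE m0 big_seq_fset0.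
  have E : m = mmul (ucm i) (divcm m (ucm i)).
    apply/eqP/cmP => j; rewrite cmM divcmE cmU.
    by case: eqVneq => [<-|]; rewrite ?subn0 // subnKC // lt0n cmE_neq0.
  have -> : mkmalgU m 1 = poly_var A i * mkmalgU (divcm m (ucm i)) 1
      :> poly_algebra A I.
    by rewrite /poly_var malgM_def fgmulUU -E mulr1.
  apply: PM => //; apply: IHn; apply: leq_trans m_n.
  by rewrite {2}E mdegM mdegU add1n.
rewrite [p]monalgE; apply: big_ind => [||m _]; [exact: P0|exact: PD|].
by rewrite malgU_scale -mul_malgC; apply: PM; [exact: PC|exact: PU].
Qed.

Section KahlerPoly.
Variables (A C S : comNzRingType) (i : {rmorphism A -> C}).
Variable e : {rmorphism C -> S}.

(** The class of [dx ⊗ 1] in [Ω_(C/A) ⊗_C S]. *)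
Definition tens_d (x : C) : tensor e (kahler i) S^o :=
  tens e (kahler_d i x) (1 : S^o).

Lemma tens_dD x y : tens_d (x + y) = tens_d x + tens_d y.
Proof. by rewrite /tens_d kahler_dD tensDl. Qed.

Lemma tens_dM x y : tens_d (x * y) = e x *: tens_d y + e y *: tens_d x.
Proof.
by rewrite /tens_d kahler_dM tensDl !tensZ !tensZr.
Qed.

Lemma tens_d_base a : tens_d (i a) = 0.
Proof.
by rewrite /tens_d kahler_d_base -(scale0r 0) tensZ rmorph0 tensZr scale0r.
Qed.

Lemma tensor_kahler_ind (W : submodule (tensor e (kahler i) S^o)) :
  (forall x, W (tens_d x)) -> forall z, W z.
Proof.
move=> Wd; apply: tensor_ind => m c.
rewrite -[c]mulr1 tensZr; apply: submoduleZ.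
(* Since [m ⊗ c = c (m ⊗ 1)], it is enough that the [m] with [m ⊗ 1] in [W] form a submodule over
   [C]. *)
have V_closed : W (tens e (0 : kahler i) (1 : S^o)) /\
    forall r (u v : kahler i), W (tens e u (1 : S^o)) ->
      W (tens e v (1 : S^o)) -> W (tens e (r *: u + v) (1 : S^o)).
  split=> [|r u v Wu Wv].
    by rewrite -(scale0r 0) tensZ rmorph0 tensZr scale0r; apply: submodule0.
  by rewrite tensDl tensZ tensZr; apply: submoduleP.
exact: (kahler_ind (W := Submodule V_closed)).
Qed.
End KahlerPoly.

Lemma tensor_kahler_poly_ind (A S : comNzRingType) (I : choiceType)
    (e : {rmorphism poly_algebra A I -> S})
    (W : submodule (tensor e (kahler (algebra_map (poly_algebra A I))) S^o)) :
  (forall t, W (tens_d _ e (poly_var A t))) -> forall z, W z.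
Proof.
move=> WX; apply: tensor_kahler_ind.
apply: (@poly_algebra_ind A I (fun p => W (tens_d _ e p))) => [a||p q|p q].
- by rewrite tens_d_base; apply: submodule0.
- exact: WX.
- by rewrite tens_dD; apply: submoduleD.
- by move=> Wp Wq; rewrite tens_dM; apply: submoduleD; apply: submoduleZ.
Qed.

Section KernelIdeal.
Variables (R S : comNzRingType) (pi : {rmorphism R -> S}).

Fact kernel_closed :
  let P : R^o -> Prop := fun r => pi r = 0 in
  P 0 /\ forall (c : R) (u v : R^o), P u -> P v -> P (c *: u + v).
Proof.
split=> [|c u v /= u0 v0]; first exact: rmorph0.
by rewrite rmorphD rmorphM u0 v0 mulr0 addr0.
Qed.
Definition kernel : ideal R := Submodule kernel_closed.

Local Notation I2 := (mul_ideal kernel kernel).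

Lemma mul_kernel (x y : R) : pi x = 0 -> pi y = 0 -> I2 (x * y).
Proof.
by move=> x0 y0; apply: sub_spanmod; exists x => //; exists y.
Qed.

(** The kernel [I] multiplies [I] into [I^2]; hence [I / I^2] is a module over [S], which is
    [conormal] below. *)
Lemma conormal_annihilated r (v : subquot kernel I2) : pi r = 0 -> r *: v = 0.
Proof.
move=> r0; have [x Ix ->] := subq_surj v.
rewrite -subqZ //; apply/subq_eq0; last exact: mul_kernel.
exact: submoduleZ.
Qed.

Variables (s : S -> R) (sK : cancel s pi).
Definition conormal : lmodType S := descent sK conormal_annihilated.

(** Two liftings of [e] to [R] differ, modulo the square of the kernel, by a
    derivation. *)
Lemma conormal_lift (A C : comNzRingType) (i : {rmorphism A -> C})
    (e : {rmorphism C -> S}) (g h : {rmorphism C -> R}) :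
  (forall x, pi (g x) = e x) -> (forall x, pi (h x) = e x) ->
  (forall a, g (i a) = h (i a)) ->
  exists L : {linear tensor e (kahler i) S^o -> conormal},
    forall x, L (tens_d i e x) = subq kernel I2 (g x - h x).
Proof.
move=> ge he gh.
have ker x : kernel (g x - h x) by rewrite /= rmorphB ge he subrr.
pose D x : conormal := subq kernel I2 (g x - h x).
have [|||L LE] := @kahler_tensor_lift A C S i e conormal D.
- move=> x y; rewrite /D -subqD //; congr subq.
  by rewrite !rmorphD opprD addrACA.
- move=> x y; rewrite /D.
  (* The scalars [g x] and [h y] act on the conormal module as [e x] and [e y], so this splitting is
     the Leibniz rule over [e]. *)
  have -> : g (x * y) - h (x * y) = g x * (g y - h y) + h y * (g x - h x).
    by rewrite !rmorphM !mulrBr addrA (mulrC (h y)) subrK (mulrC (h y)).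
  rewrite subqD ?subqZ //; [|exact: submoduleZ..].
  by rewrite -ge -he; congr (_ + _); apply/esym/descentE.
- move=> a; apply/subq_eq0 => //; rewrite gh subrr; exact: submodule0.
- by exists L => x; rewrite LE scale1r.
Qed.
End KernelIdeal.

Lemma tens_d_map (A C C' S : comNzRingType) (i : {rmorphism A -> C})
    (e : {rmorphism C -> S}) (i' : {rmorphism A -> C'})
    (e' : {rmorphism C' -> S}) (g : {rmorphism C -> C'}) :
  (forall a, g (i a) = i' a) -> (forall x, e' (g x) = e x) ->
  exists L : {linear tensor e (kahler i) S^o -> tensor e' (kahler i') S^o},
    forall x, L (tens_d i e x) = tens_d i' e' (g x).
Proof.
move=> gi e'g.
have [|||L LE] := @kahler_tensor_lift A C S i e _ (tens_d i' e' \o g).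
- by move=> x y; rewrite /= rmorphD tens_dD.
- by move=> x y; rewrite /= rmorphM tens_dM !e'g.
- by move=> a; rewrite /= gi tens_d_base.
- by exists L => x; rewrite LE scale1r.
Qed.

Lemma poly_rmorph_ext (A C : comNzRingType) (g h : {rmorphism {poly A} -> C}) :
  (forall a, g a%:P = h a%:P) -> g 'X = h 'X -> g =1 h.
Proof.
move=> ghC ghX p; elim/poly_ind: p => [|p c IHp]; first by rewrite !rmorph0.
by rewrite !rmorphD !rmorphM IHp ghX ghC.
Qed.

(** * The first homology module of a quotient of [A[X]] *)

Section AlternatingSums.
Variables (R : comNzRingType) (U V : lmodType R) (d : nat -> {linear U -> V}).

Lemma alternating_sum2 x : alternating_sum d 2 x = d 0%N x - d 1%N x.
Proof.
rewrite /alternating_sum /= /alternating_sum_fun !big_ord_recl big_ord0 addr0.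
by rewrite expr0 scale1r expr1 scaleN1r.
Qed.

Lemma alternating_sum3 x :
  alternating_sum d 3 x = d 0%N x - d 1%N x + d 2%N x.
Proof.
rewrite /alternating_sum /= /alternating_sum_fun !big_ord_recl big_ord0 addr0.
by rewrite expr0 scale1r expr1 scaleN1r expr2 mulrNN mulr1 scale1r addrA.
Qed.
End AlternatingSums.

(** Here and below, equations in [tower B n] are chained by [etrans] and
    [congr2] with explicit instances: the unification problems raised by
    rewriting would unfold the iterated polynomial algebras. *)
Section StandardComplex.
Variables (A : comNzRingType) (B : algebra A).
Local Notation T := (tower B).
Local Notation K := (kahler_complex (standard B) (B : comNzRingType)^o).

Definition std_d n (x : T n.+1) : K n :=
  tens_d (algebra_map (T n.+1)) (tower_aug B n.+1) x.

(** The elements [dX_t ⊗ 1] for [t] in [T n]; they form a basis of [K n], but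
    only the fact that they generate it is needed. *)
Definition std_gen n (t : T n) : K n := std_d (poly_var A t : T n.+1).

Lemma std_ind n (W : submodule (K n)) :
  (forall t, W (std_gen t)) -> forall z, W z.
Proof. exact: tensor_kahler_poly_ind. Qed.

Lemma kahler_face_d n i (x : T n.+2) :
  @kahler_face A B (standard B) (B : comNzRingType)^o n i (std_d x) =
  std_d (tower_face B n.+1 i x).
Proof. by rewrite /kahler_face /std_d /tens_d tensor_mapE kahler_map_d. Qed.

Lemma boundary0_d (x : T 2) :
  boundary (standard B) (B : comNzRingType)^o 0 (std_d x) =
  std_d (tower_face B 1 0 x) - std_d (tower_face B 1 1 x).
Proof.
refine (etrans (alternating_sum2 _ _) _).
exact: (congr2 (fun u v => u - v) (kahler_face_d 0 x) (kahler_face_d 1 x)).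
Qed.

Lemma boundary1_d (x : T 3) :
  boundary (standard B) (B : comNzRingType)^o 1 (std_d x) =
  std_d (tower_face B 2 0 x) - std_d (tower_face B 2 1 x) +
  std_d (tower_face B 2 2 x).
Proof.
refine (etrans (alternating_sum3 _ _) _).
refine (congr2 (fun u v => u + v) _ (kahler_face_d 2 x)).
exact: (congr2 (fun u v => u - v) (kahler_face_d 0 x) (kahler_face_d 1 x)).
Qed.

Lemma std_dD n : {morph @std_d n : x y / x + y}.
Proof. exact: tens_dD. Qed.

Lemma std_dM n (x y : T n.+1) :
  std_d (x * y) = tower_aug B n.+1 x *: std_d y + tower_aug B n.+1 y *: std_d x.
Proof. exact: tens_dM. Qed.

Lemma std_d_base n a : std_d (algebra_map (T n.+1) a) = 0.
Proof. exact: tens_d_base. Qed.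

Lemma face_var0 n (t : T n.+1) :
  tower_face B n.+1 0 (poly_var A t : T n.+2) = t.
Proof. by rewrite tower_face0; apply: poly_eval_var. Qed.

Lemma face_varS n i (t : T n.+1) :
  tower_face B n.+1 i.+1 (poly_var A t : T n.+2) =
  poly_var A (tower_face B n i t).
Proof. by rewrite tower_faceS; apply: poly_eval_var. Qed.

Lemma boundary0_gen (t : T 1) :
  boundary (standard B) (B : comNzRingType)^o 0 (std_gen t) =
  std_d t - std_gen (tower_aug B 1 t : T 0).
Proof.
refine (etrans (boundary0_d _) _).
(* [tower_face B 0 0] and [tower_aug B 1] agree up to conversion: both are the evaluation [A[B] ->
   B]. *)
exact: (congr2 (fun u v => std_d u - std_d v) (face_var0 t) (face_varS 0 t)).
Qed.

Lemma boundary1_gen (t : T 2) :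
  boundary (standard B) (B : comNzRingType)^o 1 (std_gen t) =
  std_d t - std_gen (tower_face B 1 0 t) + std_gen (tower_face B 1 1 t).
Proof.
refine (etrans (boundary1_d _) _).
refine (congr2 (fun u v => u + v) _ (congr1 (@std_d 1) (face_varS 1 t))).
exact: (congr2 (fun u v => std_d u - std_d v) (face_var0 t) (face_varS 0 t)).
Qed.

Lemma aug_var n (t : T n.+1) :
  tower_aug B n.+2 (poly_var A t : T n.+2) = tower_aug B n.+1 t.
Proof.
exact: (congr1 (tower_aug B n.+1) (poly_eval_var (D := T n.+1) id t)).
Qed.

End StandardComplex.

(** A chain-level version of the comparison of [H_1] with the kernel of
    [I / I^2 -> B]: [psi] lifts an isomorphism to chains, and [phi] is only used
    to see that [psi f] is a boundary only for [f] in [I^2]. *)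
Lemma subquot_conormal (R S : comNzRingType) (pi : {rmorphism R -> S})
    (K1 K0 Q : lmodType S)
    (d : {linear K1 -> K0}) (W : submodule K1) (N : ideal R) (psi : R -> K1)
    (phi : {linear K1 -> Q}) :
  let I2 := mul_ideal (kernel pi) (kernel pi) in
  (forall c f g, pi f = 0 -> pi g = 0 ->
     qpi W (psi (c * f + g)) = pi c *: qpi W (psi f) + qpi W (psi g)) ->
  (forall z, W z -> phi z = 0) ->
  (forall f, pi f = 0 -> phi (psi f) = 0 -> I2 f) ->
  (forall z, W z -> d z = 0) ->
  (forall z, d z = 0 -> exists2 f, pi f = 0 & qpi W z = qpi W (psi f)) ->
  (forall f, N f <-> pi f = 0 /\ d (psi f) = 0) ->
  isomorphic (restr pi (subquot (ker_submodule d) W) : lmodType R)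
    (subquot N I2).
Proof.
move=> I2 psiP phiW phi_psi dW z_psi NP.
have qpi_d z z' : qpi W z = qpi W z' -> d z = d z'.
  by move=> /qpi_eqP/dW/eqP; rewrite linearB subr_eq0 => /eqP.
have qpi_phi z z' : qpi W z = qpi W z' -> phi z = phi z'.
  by move=> /qpi_eqP/phiW/eqP; rewrite linearB subr_eq0 => /eqP.
have psi0 : qpi W (psi 0) = 0.
  have := psiP 1 0 0 (rmorph0 _) (rmorph0 _).
  rewrite mulr0 addr0 rmorph1 scale1r -{1}[qpi W (psi 0)]addr0.
  by move/addrI.
have psi_I2 f : I2 f -> qpi W (psi f) = 0.
  (* The kernel elements that [psi] sends into [W] form an ideal. It contains [x * y], because
     [psi (x * y)] is [pi x = 0] times [psi y] modulo [W]. *)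
  have cl : let P (f : R^o) := pi f = 0 /\ qpi W (psi f) = 0 in
      P 0 /\ forall (c : R) (u v : R^o), P u -> P v -> P (c *: u + v).
    split=> [|c u v [u0 Wu] [v0 Wv]]; first by rewrite rmorph0.
    by rewrite psiP // Wu Wv scaler0 addr0 rmorphD rmorphM u0 v0 mulr0 addr0.
  move=> I2f; have [] : Submodule cl f; last by [].
  apply: spanmod_min I2f => _ [x x0 [y y0 <-]] /=.
  have xy0 : pi (x * y) = 0 by rewrite rmorphM x0 mul0r.
  split; first exact: xy0.
  have := psiP x y 0 y0 (rmorph0 _).
  by rewrite addr0 x0 scale0r add0r psi0.
pose H := subquot (ker_submodule d) W.
(* A class [h] is matched with [f] when a cycle representing it is congruent to [psi f] modulo
   [W]. *)
pose P (h : restr pi H) (w : subquot N I2) := exists z f,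
  [/\ d z = 0, N f, qpi W z = qpi W (psi f),
      h = subq (ker_submodule d) W z & w = subq N I2 f].
apply: (@isomorphic_of_rel _ _ _ P).
- move=> c _ _ _ _ [z [f [z0 Nf zf -> ->]]] [z' [f' [z'0 Nf' zf' -> ->]]].
  exists (pi c *: z + z'), (c * f + f'); split.
  + by rewrite linearP z0 z'0 scaler0 addr0.
  + exact: submoduleP.
  + by rewrite (linearP (qpi W)) /= zf zf' psiP; [|case/NP: Nf|case/NP: Nf'].
  + by rewrite subqP.
  + by rewrite -subqP.
- move=> h; have [z z0 hz] := @subq_surj _ _ (ker_submodule d) W h.
  have [f f0 zf] := z_psi z z0.
  have Nf : N f by apply/NP; split; rewrite // -(qpi_d _ _ zf).
  by exists (subq N I2 f), z, f.
- move=> w; have [f Nf ->] := @subq_surj _ _ N I2 w.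
  exists (subq (ker_submodule d) W (psi f)), (psi f), f; split=> //.
  by case/NP: Nf.
- move=> w [z [f [z0 Nf zf /esym/(subq_eq0 W)Wz ->]]].
  apply/subq_eq0 => //; have [f0 _] := (NP f).1 Nf.
  by apply: phi_psi; rewrite // -(qpi_phi _ _ zf); apply/phiW/Wz.
- move=> h [z [f [z0 Nf zf -> /esym/(subq_eq0 _)I2f]]].
  apply/subq_eq0 => //; rewrite -[z]subr0; apply/qpi_eqP.
  by rewrite linear0 zf; apply/psi_I2/I2f.
Qed.

(** Modulo boundaries, [br t] will be the class of [dX_t]. The error terms [F]
    and [G] only depend on the augmentations, so that they cancel in
    differences of elements with equal augmentations. *)
Section Bracket.
Variables (R S T : comNzRingType) (pi : {rmorphism R -> S}).
Variables (tau : {rmorphism R -> T}) (eps : {rmorphism T -> S}).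
Hypothesis eps_tau : forall r, eps (tau r) = pi r.
Variables (C : lmodType S) (br : T -> C) (F G : S -> S -> C).
Hypothesis brD : forall p q, br (p + q) = br p + br q + F (eps p) (eps q).
Hypothesis brM : forall p q,
  br (p * q) = eps p *: br q + eps q *: br p + G (eps p) (eps q).

(** The error term is [F 0 (pi g)], and [brD] with [p = 0] evaluates it to [- br 0]. *)
Lemma br_addl f g : pi f = 0 ->
  br (tau (f + g)) = br (tau f) - br 0 + br (tau g).
Proof.
move=> f0; have F0 : F 0 (pi g) = - br 0.
  have := brD 0 (tau g); rewrite eps_tau rmorph0 add0r.
  rewrite -{1}[br (tau g)]add0r addrAC => /addIr/esym/eqP.
  by rewrite addrC addr_eq0 => /eqP.
by rewrite rmorphD brD !eps_tau f0 F0 addrAC.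
Qed.

(** For [h] in the kernel, the error term of [br (tau c * tau h)] is [G (pi c) 0]. It is the same
    for [h = 0], so subtracting [br 0] removes it. *)
Lemma br_linear c f g : pi f = 0 -> pi g = 0 ->
  br (tau (c * f + g)) - br 0 =
  pi c *: (br (tau f) - br 0) + (br (tau g) - br 0).
Proof.
move=> f0 g0; rewrite br_addl; last by rewrite rmorphM f0 mulr0.
rewrite -[LHS]addrA; congr (_ + _).
have E h : pi h = 0 ->
    br (tau c * tau h) = pi c *: br (tau h) + G (pi c) 0.
  by move=> h0; rewrite brM !eps_tau h0 scale0r addr0.
rewrite rmorphM E //.
have := E 0 (rmorph0 _); rewrite rmorph0 mulr0 => E0.
by rewrite [X in _ - X = _]E0 scalerBr opprD addrACA subrr addr0.
Qed.
End Bracket.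

Lemma linear_comb (R : nzRingType) (V W : lmodType R) (f : {linear V -> W})
  c d u v : f (c *: u + d *: v) = c *: f u + d *: f v.
Proof. by rewrite linearD !linearZ. Qed.

(** * Relations between the classes [[dX_t]] modulo boundaries *)

Section StandardRelations.
Variables (A : comNzRingType) (B : algebra A).
Local Notation T := (tower B).
Local Notation K := (kahler_complex (standard B) (B : comNzRingType)^o).
Local Notation bd := (boundary (standard B) (B : comNzRingType)^o).

Definition std_class : {linear K 1 -> quotmod (im_submodule (bd 1))} :=
  qpi (im_submodule (bd 1)).

Definition bracket (p : T 1) := std_class (std_gen p).

(** This is the vanishing of the boundary of the degree two generator [std_gen y]. *)
Lemma bracket_face (y : T 2) :
  bracket (tower_face B 1 0 y) =
  std_class (std_d y) + bracket (tower_face B 1 1 y).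
Proof.
have : std_class (std_d y - std_gen (tower_face B 1 0 y)
                  + std_gen (tower_face B 1 1 y)) = 0.
  rewrite -(linear0 std_class); apply: qpi_eq; rewrite subr0.
  by exists (std_gen y) => //; apply: boundary1_gen.
rewrite linearD linearB /= => /eqP.
by rewrite addrAC subr_eq0 => /eqP.
Qed.

(** Apply [bracket_face] to [X_p + X_q]: face [0] gives [p + q], while face [1] replaces both
    indices by their augmentations and yields the error term. *)
Lemma bracketD p q :
  bracket (p + q) = bracket p + bracket q +
    bracket (poly_var A (tower_aug B 1 p) + poly_var A (tower_aug B 1 q)).
Proof.
have f0 : tower_face B 1 0 (poly_var A p + poly_var A q : T 2) = p + q.
  exact: etrans (rmorphD (tower_face B 1 0) _ _)
    (congr2 (fun u v => u + v) (face_var0 p) (face_var0 q)).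
have f1 : tower_face B 1 1 (poly_var A p + poly_var A q : T 2) =
    poly_var A (tower_aug B 1 p) + poly_var A (tower_aug B 1 q).
  exact: etrans (rmorphD (tower_face B 1 1) _ _)
    (congr2 (fun u v => u + v) (face_varS 0 p) (face_varS 0 q)).
refine (etrans (congr1 bracket (esym f0)) _).
refine (etrans (bracket_face _) _).
refine (congr2 (fun u v => u + v) _ (congr1 bracket f1)).
exact: etrans (congr1 std_class (std_dD _ _)) (linearD std_class _ _).
Qed.

(** The same argument with [X_p * X_q], whose differential is given by the Leibniz rule. *)
Lemma bracketM p q :
  bracket (p * q) =
    tower_aug B 1 p *: bracket q + tower_aug B 1 q *: bracket p +
    bracket (poly_var A (tower_aug B 1 p) * poly_var A (tower_aug B 1 q)).
Proof.
have f0 : tower_face B 1 0 (poly_var A p * poly_var A q : T 2) = p * q.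
  exact: etrans (rmorphM (tower_face B 1 0) _ _)
    (congr2 (fun u v => u * v) (face_var0 p) (face_var0 q)).
have f1 : tower_face B 1 1 (poly_var A p * poly_var A q : T 2) =
    poly_var A (tower_aug B 1 p) * poly_var A (tower_aug B 1 q).
  exact: etrans (rmorphM (tower_face B 1 1) _ _)
    (congr2 (fun u v => u * v) (face_varS 0 p) (face_varS 0 q)).
refine (etrans (congr1 bracket (esym f0)) _).
refine (etrans (bracket_face _) _).
refine (congr2 (fun u v => u + v) _ (congr1 bracket f1)).
refine (etrans (congr1 std_class (std_dM _ _)) _).
refine (etrans (linear_comb std_class _ _ _ _) _).
exact: (congr2 (fun c d => c *: bracket q + d *: bracket p)
  (aug_var p) (aug_var q)).
Qed.
End StandardRelations.

Lemma poly_algebra_hom_ext (A : comNzRingType) (I : choiceType) (D : algebra A)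
    (g h : algebra_hom (poly_algebra A I) D) :
  (forall i, g (poly_var A i) = h (poly_var A i)) -> g =1 h.
Proof.
move=> ghX; apply: poly_algebra_ind => [a|//|p q gp gq|p q gp gq].
- by rewrite !algebra_funE.
- by rewrite !rmorphD gp gq.
- by rewrite !rmorphM gp gq.
Qed.

Definition upoly (A : comNzRingType) : algebra A := @Algebra A {poly A} polyC.

Lemma upoly_hom (A : comNzRingType) (D : algebra A) (t : D) :
  exists g : algebra_hom (upoly A) D, g 'X = t.
Proof.
pose g : {rmorphism {poly A} -> D} := horner_eval t \o map_poly (algebra_map D).
have gC a : g (algebra_map (upoly A) a) = algebra_map D a.
  by rewrite /g /= map_polyC /horner_eval hornerC.
exists (@AlgebraHom A (upoly A) D g gC).
by rewrite /= map_polyX /horner_eval hornerX.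
Qed.

(** This reduces [homotopy] to generators: the witness [f] is not chosen linearly in [v], but the
    vectors that have one form a submodule, a scalar [c] acting on witnesses through [s c]. *)
Lemma lift_closed (R S : comNzRingType) (pi : {rmorphism R -> S}) (s : S -> R)
    (V W : lmodType S) (k m : {linear V -> W}) (psi : R -> W) :
  cancel s pi ->
  (forall c f g, pi f = 0 -> pi g = 0 ->
     psi (c * f + g) = pi c *: psi f + psi g) ->
  let P v := exists2 f, pi f = 0 & k v = psi f - m v in
  P 0 /\ forall c u v, P u -> P v -> P (c *: u + v).
Proof.
move=> sK psiP P; split=> [|c u v [f f0 uf] [g g0 vg]].
  have := psiP 1 0 0 (rmorph0 _) (rmorph0 _).
  rewrite mulr0 addr0 rmorph1 scale1r -{1}[psi 0]addr0 => /addrI psi0.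
  exists 0; first exact: rmorph0.
  by rewrite -psi0 (linear0 k) (linear0 m) subr0.
exists (s c * f + g); first by rewrite rmorphD rmorphM f0 g0 mulr0 addr0.
by rewrite psiP // sK (linearP k) (linearP m) /= uf vg scalerBr opprD addrACA.
Qed.

(** * Comparison of the standard complex with [A[X]] *)

Section Presentation.
Variables (A : comNzRingType) (B : algebra A).
Local Notation T := (tower B).
Local Notation K := (kahler_complex (standard B) (B : comNzRingType)^o).
Local Notation bd := (boundary (standard B) (B : comNzRingType)^o).
Local Notation eps := (tower_aug B 1).
Variables (pi : algebra_hom (upoly A) B) (s : B -> upoly A).
Hypotheses (sK : cancel s pi) (sX : s (pi 'X) = 'X).
Variable tau : algebra_hom (upoly A) (T 1).
Hypothesis tauX : tau 'X = poly_var A (pi 'X).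

Lemma aug0_var (b : B) : eps (poly_var A b) = b.
Proof. exact: (poly_eval_var (D := B) id b). Qed.

Lemma eps_tau r : eps (tau r) = pi r.
Proof.
apply: (@poly_rmorph_ext _ _ (eps \o tau) pi) => [a|]; last first.
  exact: etrans (congr1 eps tauX) (aug0_var _).
exact: etrans (congr1 eps (algebra_funE tau a))
  (etrans (algebra_funE eps a) (esym (algebra_funE pi a))).
Qed.

Let sigma : algebra_hom (T 1) (upoly A) := poly_eval s.

Lemma pi_sigma p : pi (sigma p) = eps p.
Proof.
rewrite /sigma hom_poly_eval.
exact: (eq_poly_eval (C := B) (h' := id)).
Qed.

(** The normalization [sX] makes [sigma] send the variable indexed by [pi 'X] back to ['X]. *)
Lemma sigma_tau r : sigma (tau r) = r.
Proof.
apply: (@poly_rmorph_ext _ _ (sigma \o tau) idfun) => [a|].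
  exact: etrans (congr1 sigma (algebra_funE tau a)) (algebra_funE sigma a).
exact: etrans (congr1 sigma tauX)
  (etrans (poly_eval_var (D := upoly A) s (pi 'X)) sX).
Qed.

(** [lift] is a homotopy between the identity of [A[B]] ([face1_lift]) and
    [tau \o sigma] ([face0_lift]), which factors through [A[X]]. *)
Let u (b : B) : T 1 := tau (s b).
Let lift : algebra_hom (T 1) (T 2) := poly_map (u : T 0 -> T 1).

Lemma lift_var (b : T 0) : lift (poly_var A b) = poly_var A (u b).
Proof. exact: (poly_eval_var (D := T 2)). Qed.

Lemma aug_lift x : tower_aug B 2 (lift x) = eps x.
Proof.
move: x; apply: (@poly_algebra_hom_ext A (T 0) B
  (comp_hom (tower_aug B 2) lift) eps) => b.
refine (etrans (congr1 (tower_aug B 2) (lift_var b)) _).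
refine (etrans (aug_var _) _).
refine (etrans (eps_tau _) (etrans (sK b) _)).
exact: esym (aug0_var b).
Qed.

Lemma face0_lift x : tower_face B 1 0 (lift x) = tau (sigma x).
Proof.
move: x; apply: (@poly_algebra_hom_ext A (T 0) (T 1)
  (comp_hom (tower_face B 1 0) lift) (comp_hom tau sigma)) => b.
refine (etrans (congr1 (tower_face B 1 0) (lift_var b)) _).
refine (etrans (face_var0 _) _).
exact: esym (congr1 tau (poly_eval_var (D := upoly A) s b)).
Qed.

Lemma face1_lift x : tower_face B 1 1 (lift x) = x.
Proof.
move: x; apply: (@poly_algebra_hom_ext A (T 0) (T 1)
  (comp_hom (tower_face B 1 1) lift) (id_hom (T 1))) => b.
refine (etrans (congr1 (tower_face B 1 1) (lift_var b)) _).
refine (etrans (face_varS 0 _) _).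
exact: (congr1 (@poly_var A (T 0)) (etrans (eps_tau (s b)) (sK b))).
Qed.

Lemma std_lift_exists :
  exists L : {linear K 0 -> K 1}, forall x : T 1, L (std_d x) = std_d (lift x).
Proof.
exact: (tens_d_map (algebra_funE lift) aug_lift).
Qed.

(** [bracket_face] for [lift p] compares [p] with [tau (sigma p)], and [boundary0_gen] computes the
    boundary; the common term [std_d (lift p)] cancels. *)
Lemma bracket_homotopy (L : {linear K 0 -> K 1}) (p : T 1) :
  (forall x : T 1, L (std_d x) = std_d (lift x)) ->
  bracket p = bracket (tau (sigma p)) - bracket (tau (s (eps p))) -
    std_class B (L (bd 0 (std_gen p))).
Proof.
move=> LE.
have E1 : L (bd 0 (std_gen p)) = std_d (lift p) - std_gen (u (eps p)).
  refine (etrans (congr1 L (boundary0_gen p)) _).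
  refine (etrans (linearB L _ _) _).
  refine (congr2 (fun v w => v - w) (LE p) _).
  refine (etrans (LE _) (congr1 (@std_d A B 1) (lift_var _))).
have E2 : bracket (tau (sigma p)) = std_class B (std_d (lift p)) + bracket p.
  refine (etrans (congr1 (@bracket A B) (esym (face0_lift p))) _).
  refine (etrans (bracket_face _) _).
  exact: (congr1 (fun v => std_class B (std_d (lift p)) + bracket v)
    (face1_lift p)).
have E3 : std_class B (L (bd 0 (std_gen p))) =
    std_class B (std_d (lift p)) - bracket (tau (s (eps p))).
  exact: etrans (congr1 (std_class B) E1) (linearB (std_class B) _ _).
rewrite E3 E2; move: (std_class B _) (bracket p) (bracket _) => x y t.
by rewrite opprB addrA subrK addrAC subrr add0r.
Qed.

(** Subtracting the value at [0] cancels the error terms of [bracketD] and [bracketM], which makes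
    this linear on the kernel of [pi]. *)
Definition psi_class (f : upoly A) := bracket (tau f) - @bracket A B 0.

Lemma psi_class_linear c f g : pi f = 0 -> pi g = 0 ->
  psi_class (c * f + g) = pi c *: psi_class f + psi_class g.
Proof.
exact: (@br_linear _ _ _ pi tau eps eps_tau _ (@bracket A B)
  (fun b c => bracket (@poly_var A (T 0) b + @poly_var A (T 0) c))
  (fun b c => bracket (@poly_var A (T 0) b * @poly_var A (T 0) c))
  (@bracketD A B) (@bracketM A B) c f g).
Qed.

(** For a cycle [z] the last term vanishes, so every cycle is homologous to some [psi_chain f]. On
    the generator indexed by [p], the witness is [sigma p - s (eps p)]. *)
Lemma homotopy (L : {linear K 0 -> K 1}) (z : K 1) :
  (forall x : T 1, L (std_d x) = std_d (lift x)) ->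
  exists2 f, pi f = 0 & std_class B z = psi_class f - std_class B (L (bd 0 z)).
Proof.
move=> LE.
pose m : {linear K 1 -> _} := std_class B \o (L \o bd 0).
have cl := @lift_closed _ _ pi s _ _ (std_class B) m psi_class sK
  psi_class_linear.
move: z; apply: (std_ind (W := Submodule cl)) => p.
have ker : pi (sigma p - s (eps p)) = 0.
  by rewrite rmorphB pi_sigma sK subrr.
have E : bracket (tau (sigma p)) - bracket (tau (s (eps p))) =
    psi_class (sigma p - s (eps p)).
  have := @br_addl _ _ _ pi tau eps eps_tau _ (@bracket A B)
    (fun b c => bracket (@poly_var A (T 0) b + @poly_var A (T 0) c))
    (@bracketD A B) (sigma p - s (eps p)) (s (eps p)) ker.
  by rewrite subrK => ->; rewrite addrK.
exists (sigma p - s (eps p)); first exact: ker.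
refine (etrans (bracket_homotopy p LE) _).
exact: (congr1 (fun v => v - std_class B (L (bd 0 (std_gen p)))) E).
Qed.

Lemma std_d_tau f : std_d (tau f) = pi (f^`()) *: std_gen (pi 'X : T 0).
Proof.
have d0 a : std_d (tau a%:P) = 0.
  refine (etrans (congr1 (@std_d A B 0) (algebra_funE tau a)) _).
  exact: std_d_base.
elim/poly_ind: f => [|p c IHp].
  refine (etrans (d0 0) _).
  by rewrite deriv0 rmorph0 scale0r.
refine (etrans (congr1 (@std_d A B 0) (rmorphD tau _ _)) _).
refine (etrans (std_dD _ _) _).
refine (etrans (congr2 (fun v w => v + w)
  (etrans (congr1 (@std_d A B 0) (rmorphM tau _ _)) (std_dM _ _)) (d0 c)) _).
transitivity (pi p *: std_gen (pi 'X : T 0) +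
    pi 'X *: (pi (p^`()) *: std_gen (pi 'X : T 0)) + 0).
  exact: (congr2 (fun v w => v + w + 0)
    (congr2 (fun c t => c *: std_d (t : T 1)) (eps_tau p) tauX)
    (congr2 (fun c v => c *: v)
      (etrans (congr1 eps tauX) (aug0_var _)) IHp)).
have E : pi (deriv (p * 'X + c%:P)) = pi p + pi 'X * pi (p^`()).
  rewrite derivD derivC addr0 derivM derivX mulr1 addrC mulrC.
  exact: etrans (rmorphD pi _ _)
    (congr1 (fun v => pi p + v) (rmorphM pi _ _)).
have scale (V : lmodType B) (x : V) (e f g : B) :
    e *: x + f *: (g *: x) + 0 = (e + f * g) *: x.
  by rewrite addr0 scalerA -scalerDl.
exact: etrans (scale _ _ _ _ _)
  (congr1 (fun e => e *: std_gen (pi 'X : T 0)) (esym E)).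
Qed.

Definition psi_chain (f : upoly A) : K 1 := std_gen (tau f) - std_gen (0 : T 1).

Lemma std_class_psi f : std_class B (psi_chain f) = psi_class f.
Proof. exact: linearB. Qed.

(** The two generators indexed by augmentations are both [std_gen 0] and cancel; the chain rule
    [std_d_tau] gives the rest. *)
Lemma boundary_psi f : pi f = 0 ->
  bd 0 (psi_chain f) = pi (f^`()) *: std_gen (pi 'X : T 0).
Proof.
move=> f0; refine (etrans (linearB (bd 0) _ _) _).
have E g : pi g = 0 -> bd 0 (std_gen (tau g)) =
    pi (g^`()) *: std_gen (pi 'X : T 0) - std_gen (0 : T 0).
  move=> g0; refine (etrans (boundary0_gen _) _).
  exact: (congr2 (fun v w => v - std_gen (w : T 0)) (std_d_tau g)
    (etrans (eps_tau g) g0)).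
have pi0' : pi (deriv (0 : {poly A})) = 0 by rewrite deriv0 rmorph0.
have E0 : bd 0 (std_gen (0 : T 1)) =
    0 *: std_gen (pi 'X : T 0) - std_gen (0 : T 0).
  refine (etrans (esym (congr1 (fun t => bd 0 (std_gen t)) (rmorph0 tau))) _).
  refine (etrans (E 0 (rmorph0 pi)) _).
  exact: (congr1
    (fun c => c *: std_gen (pi 'X : T 0) - std_gen (0 : T 0)) pi0').
refine (etrans (congr2 (fun v w => v - w) (E f f0) E0) _).
have cancel (V : lmodType B) (x y : V) (c : B) :
    c *: x - y - (0 *: x - y) = c *: x.
  by rewrite scale0r sub0r opprK subrK.
exact: cancel.
Qed.

Lemma std_gen_free (c : B) : c *: std_gen (pi 'X : T 0) = 0 -> c = 0.
Proof.
pose D (p : T 1) : (B : comNzRingType)^o := pi (deriv (sigma p)).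
have [|||L LE] := @kahler_tensor_lift A (T 1) B (algebra_map (T 1)) eps
  (B : comNzRingType)^o D.
- by move=> x y; rewrite /D rmorphD derivD rmorphD.
- move=> x y; rewrite /D rmorphM derivM rmorphD !rmorphM !pi_sigma addrC.
  by congr (_ + _); rewrite mulrC.
- by move=> a; rewrite /D (algebra_funE sigma a) derivC rmorph0.
move=> /(congr1 L); rewrite linearZ linear0.
have -> : L (std_gen (pi 'X : T 0)) = 1.
  refine (etrans (LE _ _) _); rewrite scale1r /D.
  have -> : sigma (poly_var A (pi 'X : T 0)) = 'X.
    exact: (etrans (poly_eval_var (D := upoly A) s _) sX).
  by rewrite derivX rmorph1.
by move=> c0; exact: etrans (esym (mulr1 c)) c0.
Qed.

Lemma boundary_psi_eq0 f : pi f = 0 ->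
  bd 0 (psi_chain f) = 0 <-> pi (f^`()) = 0.
Proof.
move=> f0; split=> [E|f'0].
  exact/std_gen_free/(etrans (esym (boundary_psi f0)) E).
have scale0 (V : lmodType B) (x : V) (c : B) : c = 0 -> c *: x = 0.
  by move=> ->; rewrite scale0r.
exact: etrans (boundary_psi f0) (scale0 _ _ _ f'0).
Qed.

Local Notation I2 := (mul_ideal (kernel pi) (kernel pi)).

(** The two faces followed by [sigma] both lift the augmentation of [A[A[B]]], so [conormal_lift]
    applies to them. *)
Lemma phi_exists :
  exists phi : {linear K 1 -> conormal sK},
    forall x : T 2, phi (std_d x) = subq (kernel pi) I2
      (sigma (tower_face B 1 0 x) - sigma (tower_face B 1 1 x)).
Proof.
pose g i : algebra_hom (T 2) (upoly A) := comp_hom sigma (tower_face B 1 i).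
have pig i x : pi (g i x) = tower_aug B 2 x.
  exact: etrans (pi_sigma _) (@tower_aug_face A B 1 i x).
have gA a : g 0%N (algebra_map (T 2) a) = g 1%N (algebra_map (T 2) a).
  exact: etrans (algebra_funE (g 0%N) a) (esym (algebra_funE (g 1%N) a)).
exact: (conormal_lift sK (pig 0%N) (pig 1%N) gA).
Qed.

Section Phi.
Variable phi : {linear K 1 -> conormal sK}.
Hypothesis phiE : forall x : T 2, phi (std_d x) =
  subq (kernel pi) I2 (sigma (tower_face B 1 0 x) - sigma (tower_face B 1 1 x)).

Lemma phi_gen (p : T 1) :
  phi (std_gen p) = subq (kernel pi) I2 (sigma p - s (eps p)).
Proof.
refine (etrans (phiE _) (congr1 (subq (kernel pi) I2) _)).
refine (congr2 (fun v w => v - w) (congr1 sigma (face_var0 p)) _).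
refine (etrans (congr1 sigma (face_varS 0 p)) _).
exact: (poly_eval_var (D := upoly A) s (eps p)).
Qed.

Lemma kernel_sigma (p : T 1) : kernel pi (sigma p - s (eps p)).
Proof.
refine (etrans (rmorphB pi _ _) (etrans _ (subrr (eps p)))).
exact: (congr2 (fun v w => v - w) (pi_sigma p) (sK _)).
Qed.

(** On a generator, [boundary1_gen] and [phi_gen] leave only the difference of the [s (eps _)] of
    the two faces of [t], and these faces have equal augmentations. *)
Lemma phi_boundary (z : K 2) : phi (bd 1 z) = 0.
Proof.
apply: (std_ind (W := ker_submodule (phi \o bd 1))) => t.
refine (etrans (congr1 phi (boundary1_gen t)) _).
refine (etrans (linearD phi _ _) _).
refine (etrans (congr2 (fun v w => v + w) (linearB phi _ _) (phi_gen _)) _).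
refine (etrans (congr2 (fun v w => v - w + _) (phiE t) (phi_gen _)) _).
have E : eps (tower_face B 1 0 t) = eps (tower_face B 1 1 t).
  exact: etrans (@tower_aug_face A B 1 0 t) (esym (@tower_aug_face A B 1 1 t)).
have ker0 := kernel_sigma (tower_face B 1 0 t).
have ker1 := kernel_sigma (tower_face B 1 1 t).
have alg (V : zmodType) (v w : V) : v - w - v + w = 0.
  by rewrite addrAC subrK subrr.
refine (etrans (congr1 (fun v => v - _ + _) _) (alg _ _ _)).
refine (etrans (congr1 (subq (kernel pi) I2) _) (subqB I2 ker0 ker1)).
by rewrite E opprB addrA subrK.
Qed.

Lemma phi_psi f : pi f = 0 -> phi (psi_chain f) = subq (kernel pi) I2 f.
Proof.
move=> f0; refine (etrans (linearB phi _ _) _).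
refine (etrans (congr2 (fun v w => v - w) (phi_gen _) (phi_gen _)) _).
have := kernel_sigma (tau f); have := kernel_sigma 0.
rewrite (eps_tau f) (sigma_tau f) (rmorph0 sigma) (rmorph0 eps) f0.
move=> ker0 kerf; refine (etrans (esym (subqB I2 kerf ker0)) _).
(* The value [s 0] may be nonzero, but it occurs twice and cancels. *)
by congr (subq _ _ _); rewrite sub0r opprK subrK.
Qed.
End Phi.

End Presentation.

Section FirstHomology.
Variables (A B : comNzRingType) (f : {rmorphism A -> B}).
Variable pi : {rmorphism {poly A} -> B}.

Fact critical_closed :
  let P : {poly A}^o -> Prop :=
    fun p => pi p = 0 /\ pi (p : {poly A})^`() = 0 in
  P 0 /\ forall (c : {poly A}) (u v : {poly A}^o), P u -> P v -> P (c *: u + v).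
Proof.
split=> [|c u v [u0 u'0] [v0 v'0]]; first by rewrite deriv0 rmorph0.
split; first by rewrite rmorphD rmorphM u0 v0 mulr0 addr0.
have -> : deriv (c *: u + v) = (deriv c * u + c * deriv u + deriv v : {poly A}).
  by rewrite derivD derivM.
by rewrite !rmorphD !rmorphM u0 u'0 v'0 !mulr0 !addr0.
Qed.

(** The kernel of [I -> Ω_(A[X]/A) ⊗ B], where [I] is the kernel of [pi]. *)
Definition critical_ideal : ideal {poly A} := Submodule critical_closed.

Hypothesis piC : forall a, pi a%:P = f a.
Hypothesis pi_surj : forall b, exists p, pi p = b.

Lemma andre_quillen1 :
  isomorphic
    (restr pi (andre_quillen f (B^o : lmodType B) 1) : lmodType {poly A})
    (subquot critical_ideal (mul_ideal (kernel pi) (kernel pi))).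
Proof.
have [s0 s0K] := choice pi_surj.
(* An arbitrary section is corrected at [pi 'X], so that [sigma] becomes a left inverse of [tau]. *)
pose s b := if b == pi 'X then 'X else s0 b.
have sK : cancel s pi by move=> b; rewrite /s; case: eqP => [->|].
have sX : s (pi 'X) = 'X by rewrite /s eqxx.
pose Bf := Algebra f.
pose pih : algebra_hom (upoly A) Bf := @AlgebraHom A (upoly A) Bf pi piC.
have sKh : @cancel (upoly A) Bf s pih := sK.
have sXh : (s : Bf -> upoly A) (pih 'X) = 'X := sX.
have [tau tauX] := @upoly_hom A (tower Bf 1) (poly_var A (pih 'X : tower Bf 0)).
have [L LE] := std_lift_exists sKh tauX.
have [phi phiE] := phi_exists sKh.
apply: (@subquot_conormal {poly A} B pi _ _ _
  (boundary (standard Bf) (B^o : lmodType B) 0)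
  (im_submodule (boundary (standard Bf) (B^o : lmodType B) 1))
  critical_ideal (psi_chain tau) phi).
- move=> c p q p0 q0.
  refine (etrans (std_class_psi tau _) _).
  refine (etrans (psi_class_linear tauX c p0 q0) _).
  exact: (congr2 (fun v w => (pi c : B) *: v + w)
    (esym (std_class_psi tau p)) (esym (std_class_psi tau q))).
- move=> _ [z _ <-]; exact: (phi_boundary phiE).
- move=> p p0 phi0; apply/(@subq_eq0 _ _ (kernel pi)) => //.
  exact: etrans (esym (phi_psi (sK := sKh) sXh tauX phiE p0)) phi0.
- move=> _ [z _ <-]; exact: boundary_boundary.
- move=> z z0; have [p p0 zp] := homotopy sKh tauX z LE.
  exists p; first exact: p0.
  refine (etrans zp (etrans _ (esym (std_class_psi tau p)))).
  have E : std_class Bf (L (boundary (standard Bf) (B^o : lmodType B) 0 z)) = 0.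
    refine (etrans (congr1 (fun v => std_class Bf (L v)) z0) _).
    exact: etrans (congr1 (std_class Bf) (linear0 L)) (linear0 (std_class Bf)).
  exact: etrans (congr1 (fun v => psi_class tau p - v) E) (subr0 _).
- move=> p; split=> -[p0 p'0]; split=> //.
    exact: (boundary_psi_eq0 sKh sXh tauX p0).2 p'0.
  exact: (boundary_psi_eq0 sKh sXh tauX p0).1 p'0.
Qed.
End FirstHomology.

(** * The ring [A[a/b]] over an integrally closed domain *)

Section IntegralClosure.
Variable A : idomainType.
Hypothesis A_closed : integrally_closed A.
Variables a b : A.
Hypothesis b_neq0 : b != 0.
Local Notation F := (@tofrac A).
Local Notation x := (F a / F b).
Local Notation pi := (adjoin_eval a b).
Local Notation ev p := (map_poly F p).[x].

Lemma pi_eq p q : pi p = pi q <-> ev p = ev q.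
Proof. by split=> [/(congr1 val)|/= E]; last exact: val_inj. Qed.

Lemma pi_eq0 p : pi p = 0 <-> ev p = 0.
Proof.
rewrite -[0 in X in X <-> _](rmorph0 pi) pi_eq.
by rewrite rmorph0 horner0.
Qed.

Let Fb_neq0 : F b != 0. Proof. by rewrite tofrac_eq0. Qed.

Lemma ev_ratio p q : a *: p = b *: q -> ev q = x * ev p.
Proof.
move=> /(congr1 (fun r => ev r)); rewrite !map_polyZ !hornerZ => E.
by apply: (mulfI Fb_neq0); rewrite -E mulrA mulrCA mulfV // mulr1.
Qed.

Lemma fraction_ratio c d : F c * x = F d -> a * c = b * d.
Proof.
move=> E; apply/eqP; rewrite -tofrac_eq !rmorphM /= -E.
by rewrite mulrCA [F b * _]mulrC divfK // mulrC.
Qed.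

(** If [p] has degree [n + 1] and leading coefficient [c], then multiplying
    [p(a/b) = 0] by [c^n] gives a monic equation for [c a/b]. *)
Lemma integral_lead_ratio p : pi p = 0 -> exists d, a * lead_coef p = b * d.
Proof.
move=> /pi_eq0 p_x; have [->|p_neq0] := eqVneq p 0.
  by exists 0; rewrite lead_coef0 !mulr0.
set c := lead_coef p; pose n := (size p).-1.
have sp : size p = n.+1 by rewrite prednK // size_poly_gt0.
suff /A_closed[d E] : integralOver F (F c * x).
  by exists d; apply: fraction_ratio.
pose q := 'X^n + \poly_(i < n) (p`_i * c ^+ (n.-1 - i)).
exists q.
  rewrite monicE lead_coefDl ?lead_coefXn // size_polyXn ltnS.
  exact: size_poly.
(* Degree [0] is excluded, as a nonzero constant does not vanish at [x]. From here on, [n] is the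
   degree minus one. *)
case: n => [|n] in sp q *.
  have pC : p = (p`_0)%:P by apply: size1_polyC; rewrite sp.
  move: p_x p_neq0; rewrite pC map_polyC hornerC => /eqP.
  by rewrite tofrac_eq0 => /eqP ->; rewrite polyC0 eqxx.
have cE : c = p`_n.+1 by rewrite /c /lead_coef sp.
have {}p_x : F c * x ^+ n.+1 = - \sum_(i < n.+1) F p`_i * x ^+ i.
  apply/eqP; rewrite -addr_eq0 addrC; apply/eqP; rewrite -[RHS]p_x.
  rewrite (@horner_coef_wide _ n.+2); last by rewrite -sp; apply: size_poly.
  rewrite [RHS]big_ord_recr /= coef_map cE; congr (_ + _).
  by apply: eq_bigr => i _; rewrite coef_map.
have q_n : \sum_(i < n.+1) F (p`_i * c ^+ (n - i)) * (F c * x) ^+ i =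
    F c ^+ n * \sum_(i < n.+1) F p`_i * x ^+ i.
  rewrite mulr_sumr; apply: eq_bigr => i _.
  rewrite rmorphM rmorphXn /= exprMn -mulrA [F c ^+ (n - i) * _]mulrA -exprD.
  by rewrite subnK 1?mulrCA // -ltnS.
rewrite /root /q rmorphD /= map_polyXn hornerD hornerXn.
rewrite (@horner_coef_wide _ n.+1); last first.
  by apply: leq_trans (size_poly _ _) _; apply: size_poly.
rewrite [X in _ + X](_ : _ = F c ^+ n * \sum_(i < n.+1) F p`_i * x ^+ i).
  by rewrite exprMn exprSr -mulrA p_x mulrN addNr.
by rewrite -q_n; apply: eq_bigr => i _; rewrite coef_map coef_poly ltn_ord.
Qed.

(** With [c x^2 = e], the element [c x] is a root of the monic polynomial [X^2 - c e]. *)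
Lemma square_ratio c e : a ^+ 2 * c = b ^+ 2 * e ->
  exists d, a * c = b * d /\ a * d = b * e.
Proof.
move=> ce; have E : F c * x ^+ 2 = F e.
  have Fce : F a ^+ 2 * F c = F b ^+ 2 * F e.
    by rewrite -!tofracXn -!tofracM ce.
  apply: (mulfI (expf_neq0 2 Fb_neq0)); rewrite -Fce expr_div_n mulrCA.
  by rewrite [_ ^+ 2 / _]mulrC mulVKf ?expf_neq0 // mulrC.
have /A_closed[d dE] : integralOver F (F c * x).
  exists ('X^2 - (c * e)%:P).
    rewrite monicE lead_coefDl ?lead_coefXn // size_polyXn size_polyN.
    exact: leq_ltn_trans (size_polyC_leq1 _) _.
  rewrite /root rmorphB /= map_polyXn map_polyC /= hornerD hornerN hornerXn.
  by rewrite hornerC subr_eq0 tofracM -E exprMn expr2 -mulrA.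
exists d; have cd := fraction_ratio dE; split=> //.
by apply: (mulfI b_neq0); rewrite mulrCA -cd !mulrA -!expr2 ce.
Qed.

(** Here [a q = b r] encodes [r = x q], so that [p = (X - x) q]. The proof is a descent on the
    degree. *)
Lemma kernel_factor p : pi p = 0 ->
  exists q r, p = 'X * q - r /\ a *: q = b *: r.
Proof.
have [n] := ubnP (size p); elim: n => // n IHn in p *; rewrite ltnS => p_n p0.
have [->|p_neq0] := eqVneq p 0.
  by exists 0, 0; rewrite mulr0 subrr !scaler0.
have [d cd] := integral_lead_ratio p0; set c := lead_coef p in cd.
case: n => [|n] in IHn p_n *.
  by move: p_n p_neq0; rewrite leqn0 size_poly_eq0 => ->.
have [d0|d_gt0] := posnP (size p).-1.
  have pC : p = c%:P.
    by rewrite /c lead_coefE d0; apply: size1_polyC; rewrite -subn_eq0 subn1 d0.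
  move: p0 p_neq0 => /pi_eq0; rewrite pC map_polyC hornerC => /eqP.
  by rewrite tofrac_eq0 => /eqP ->; rewrite polyC0 eqxx.
set k := (size p).-2.
have sp : size p = k.+2.
  by rewrite /k; case: (size p) d_gt0 => [|[|m]].
have E0 : 'X^k * (c *: 'X - d%:P) = c *: 'X^(k.+1) - d *: 'X^k.
  by rewrite mulrBr -scalerAr -exprSr mulrC mul_polyC.
(* With [c x = d], the polynomial [X^k (c X - d)] lies in the kernel and has the leading term of
   [p], whose degree is [k + 1]. *)
have [||q [r [E qr]]] := IHn (p - 'X^k * (c *: 'X - d%:P)).
- apply: leq_trans p_n; rewrite sp ltnS E0.
  apply/leq_sizeP => j; rewrite leq_eqVlt => /predU1P[<-|kj].
    rewrite !coefB !coefZ !coefXn eqxx gtn_eqF // mulr0 subr0 mulr1 /c.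
    by rewrite lead_coefE sp subrr.
  rewrite !coefB !coefZ !coefXn !gtn_eqF ?(ltnW kj) // !mulr0 !subr0.
  by apply: nth_default; rewrite sp.
- rewrite rmorphB p0 sub0r rmorphM.
  have -> : pi (c *: 'X - d%:P) = 0; last by rewrite mulr0 oppr0.
  apply/pi_eq0/(mulfI Fb_neq0).
  rewrite mulr0 rmorphB /= map_polyZ map_polyX map_polyC hornerD hornerN.
  rewrite hornerZ hornerX hornerC mulrBr.
  by rewrite mulrCA [F b * x]mulrC divfK // -!tofracM mulrC cd subrr.
exists (q + c *: 'X^k), (r + d *: 'X^k); split; last first.
  by rewrite !scalerDr qr !scalerA cd.
move/eqP: E; rewrite subr_eq => /eqP ->; rewrite E0 mulrDr opprD addrACA.
by rewrite -scalerAr exprS.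
Qed.

End IntegralClosure.

(** * Differentials of a quotient of [A[X]] *)

Lemma isomorphic_restr (R S : nzRingType) (f : {rmorphism R -> S})
    (V W : lmodType S) :
  isomorphic V W ->
  isomorphic (restr f V : lmodType R) (restr f W : lmodType R).
Proof.
move=> [g g_bij]; have g_lin : linear (g : restr f V -> restr f W).
  by move=> c u v; rewrite linearP.
pose g' : {linear restr f V -> restr f W} :=
  HB.pack (g : restr f V -> restr f W)
  (GRing.isLinear.Build R (restr f V) (restr f W) _ g g_lin).
by exists g'.
Qed.

Lemma kahler_presentation (A B : comNzRingType) (f : {rmorphism A -> B})
    (pi : {rmorphism {poly A} -> B}) (D : ideal B) :
  (forall a, pi a%:P = f a) -> (forall b, exists p, pi p = b) ->
  (forall p, pi p = 0 -> D (pi p^`())) ->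
  (forall c : B, D c -> c *: kahler_d f (pi 'X) = 0) ->
  isomorphic (kahler f) (quotmod D).
Proof.
move=> piC /choice[s sK] D_deriv D_ann; pose x := pi 'X.
pose d (b : B) : quotmod D := qpi D (pi (s b)^`()).
have dE p : d (pi p) = qpi D (pi p^`()).
  apply: qpi_eq; rewrite -rmorphB -derivB.
  by apply: D_deriv; rewrite rmorphB sK subrr.
have [|||L LE] := @kahler_lift A B f (quotmod D) d.
- by move=> b c; rewrite -(sK b) -(sK c) -rmorphD !dE derivD rmorphD linearD.
- move=> b c; rewrite -(sK b) -(sK c) -rmorphM !dE derivM rmorphD !rmorphM.
  by rewrite -!linearZ -linearD addrC; congr (qpi D (_ + _)); rewrite mulrC.
- by move=> a; rewrite -piC dE derivC rmorph0 linear0.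
have dx p : kahler_d f (pi p) = pi p^`() *: kahler_d f x.
  elim/poly_ind: p => [|p c IHp].
    by rewrite deriv0 !rmorph0 scale0r -(rmorph0 f) kahler_d_base.
  rewrite rmorphD rmorphM piC kahler_dD kahler_d_base addr0 kahler_dM IHp.
  rewrite scalerA -scalerDl derivD derivC addr0 derivM derivX mulr1.
  by rewrite rmorphD rmorphM addrC [pi 'X * _]mulrC.
have gen : let P w := exists c : B, w = c *: kahler_d f x in
    P 0 /\ forall c u v, P u -> P v -> P (c *: u + v).
  split=> [|c _ _ [u ->] [v ->]]; first by exists 0; rewrite scale0r.
  by exists (c * u + v); rewrite scalerDl scalerA.
have Lx : L (kahler_d f x) = qpi D 1 by rewrite LE dE derivX rmorph1.
have qpi1 (c : B) : c *: qpi D 1 = qpi D c.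
  by rewrite -linearZ; congr (qpi D _); apply: mulr1.
apply: (@isomorphic_of_rel _ _ _
  (fun w q => exists2 c : B, w = c *: kahler_d f x & q = qpi D c)).
- move=> c _ _ _ _ [u -> ->] [v -> ->]; exists (c * u + v).
    by rewrite scalerDl scalerA.
  by rewrite -linearP.
- move=> w; have [|c ->] := @kahler_ind _ _ _ (Submodule gen) _ w.
    by move=> b; rewrite -(sK b) dx; exists (pi (s b)^`()).
  by exists (qpi D c), c.
- by move=> q; exists (repr q *: kahler_d f x), (repr q); rewrite ?qpiK.
- move=> _ [c /(congr1 L) + ->].
  by rewrite linear0 linearZ /= Lx qpi1 => /esym.
- move=> _ [c -> /esym]; rewrite -(linear0 (qpi D)) => /qpi_eqP.
  by rewrite subr0; apply: D_ann.
Qed.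

Section Annihilator.
Variables (R : comNzRingType) (V : lmodType R) (v : V).

Fact annihilator_closed :
  let P : R^o -> Prop := fun c => (c : R) *: v = 0 in
  P 0 /\ forall (c : R) (u w : R^o), P u -> P w -> P (c *: u + w).
Proof.
split=> [|c u w u0 w0]; first exact: scale0r.
by rewrite scalerDl w0 addr0 -scalerA u0 scaler0.
Qed.
Definition annihilator : ideal R := Submodule annihilator_closed.
End Annihilator.

(** * Differentials of [A[a/b]] and the ideal [(bA : a)] *)

Section AdjoinIdeals.
Variable A : idomainType.
Hypothesis A_closed : integrally_closed A.
Variables a b : A.
Hypotheses (a_neq0 : a != 0) (b_neq0 : b != 0).
Local Notation pi := (adjoin_eval a b).
Local Notation i := (adjoin_map a b).
Local Notation J := (colon (principal b) a).
Local Notation J' := (colon (principal a) b).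
Local Notation JB := (extend_ideal i J).
Local Notation M := (principal (a * b)).
Local Notation N := (mul_ideal (add_submodule (principal a) (principal b))
  (cap_submodule (principal a) (principal b))).
Local Notation C := (polyC : {rmorphism A -> {poly A}}).

Lemma adjoin_eval_surj (y : adjoin a b) : exists p, pi p = y.
Proof.
case: y => y y_in; have /adjoin_predP[p E] := y_in.
by exists p; apply: val_inj.
Qed.

Lemma colonP c : J c <-> exists d, a * c = b * d.
Proof.
split=> [[d _ E]|[d E]]; first by exists d; rewrite E mulrC.
by exists d => //; rewrite -E mulrC.
Qed.

(** Compared with [colonP], this says that [J'] is [a/b] times [J]. *)
Lemma colon'P d : J' d <-> exists c, a * c = b * d.
Proof.
split=> [[c _ E]|[c E]]; first by exists c; rewrite E mulrC.
by exists c => //; rewrite E mulrC.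
Qed.

Lemma pi_ratio p q : a *: p = b *: q -> pi q = pi 'X * pi p.
Proof.
move=> E; rewrite -rmorphM; apply/pi_eq.
by rewrite (ev_ratio b_neq0 E) rmorphM /= hornerM map_polyX hornerX.
Qed.

Lemma deriv_ratio p q : a *: p = b *: q -> a *: p^`() = b *: q^`().
Proof. by rewrite -!derivZ => ->. Qed.

(** The derivative is [q + X q' - r'], and [r' = (a/b) q'] by differentiating the hypothesis. *)
Lemma pi_deriv q r : a *: q = b *: r -> pi ('X * q - r)^`() = pi q.
Proof.
move=> E; rewrite derivB derivM derivX mul1r !rmorphB rmorphD rmorphM.
by rewrite -(pi_ratio (deriv_ratio E)) addrK.
Qed.

Lemma extend_colon q r : a *: q = b *: r -> JB (pi q).
Proof.
move=> E; rewrite -[q]coefK poly_def rmorph_sum; apply: submodule_sum => k _.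
rewrite -mul_polyC rmorphM mulrC; apply: submoduleZ.
apply: sub_spanmod; exists q`_k => //; apply/colonP; exists r`_k.
by rewrite -!coefZ E.
Qed.

(** Derivatives of kernel elements evaluate to [q(a/b)] with [q] in [J[X]], hence lie in [J B].
    Conversely, for [d] in [J] the product [d (a/b)] is in [A], so [d] kills the differential of
    [a/b]. *)
Lemma kahler_adjoin :
  isomorphic (restr pi (kahler i) : lmodType {poly A})
    (restr pi (quotmod JB) : lmodType {poly A}).
Proof.
apply/isomorphic_restr/(@kahler_presentation _ _ i pi) => //.
- exact: adjoin_eval_surj.
- move=> p p0; have [q [r [-> E]]] := kernel_factor A_closed b_neq0 p0.
  by rewrite pi_deriv //; apply: extend_colon E.
- move=> c; apply: (@spanmod_min _ _ _ (annihilator _)).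
  move=> _ [d /colonP[e E] <-].
  have : kahler_d i (i d * pi 'X) = 0.
    have -> : i d * pi 'X = i e.
      rewrite mulrC -(@pi_ratio d%:P e%:P) //.
      by rewrite -!mul_polyC -!polyCM E.
    exact: kahler_d_base.
  by rewrite kahler_dM kahler_d_base scaler0 addr0.
Qed.

Lemma coef_kernel p k : pi p = 0 -> add_submodule J J' p`_k.
Proof.
move=> p0; have [q [r [-> E]]] := kernel_factor A_closed b_neq0 p0.
have Ek j : a * q`_j = b * r`_j by rewrite -!coefZ E.
rewrite coefB coefXM; exists (if k == 0%N then 0 else q`_k.-1).
  case: eqP => _; first exact: submodule0.
  by apply/colonP; exists r`_k.-1.
exists (- r`_k) => //; apply: (@submoduleN _ _ J').
by apply/colon'P; exists q`_k.
Qed.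

(** The elements of [B] with some preimage in [(J + J')[X]] form an ideal containing [J]. Any other
    preimage differs by a kernel element, to which [coef_kernel] applies. *)
Lemma coef_extend p k : JB (pi p) -> add_submodule J J' p`_k.
Proof.
pose P (y : adjoin a b) :=
  exists2 q, pi q = y & forall k, add_submodule J J' q`_k.
have cl : P 0 /\ forall (c u v : adjoin a b), P u -> P v -> P (c * u + v).
  split=> [|c _ _ [q <- Jq] [r <- Jr]].
    by exists 0 => [|j]; rewrite ?rmorph0 // coef0; apply: submodule0.
  have [d <-] := adjoin_eval_surj c; exists (d * q + r) => [|j].
    by rewrite rmorphD rmorphM.
  rewrite coefD coefM; apply: submoduleD => //; apply: submodule_sum => l _.
  exact: (@submoduleZ _ _ (add_submodule J J')).
move=> /(spanmod_min (W := @Submodule _ (adjoin a b)^o P cl)) [].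
  move=> _ [c Jc <-]; exists c%:P => // j; rewrite coefC.
  case: eqP => _; last exact: submodule0.
  by exists c => //; exists 0; [exact: submodule0 | exact: addr0].
move=> q E Jq; rewrite -[p](subrK q) coefD; apply: submoduleD => //.
by apply: coef_kernel; rewrite rmorphB E subrr.
Qed.

(** With [Q := aA :&: bA] one has [a J = Q = b J'], so that
    [(aA + bA) Q = ab (J + J')]. *)
Lemma mul_ideal_colon u : N (a * b * u) <-> add_submodule J J' u.
Proof.
split=> [|[c /colonP[d cd] [d' /colon'P[c' cd'] <-]]].
  pose P : A^o -> Prop :=
    fun v => exists2 u, add_submodule J J' u & v = a * b * u.
  have cl : P 0 /\ forall (c : A) (u v : A^o), P u -> P v -> P (c *: u + v).
    split=> [|c _ _ [v Jv ->] [w Jw ->]].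
      by exists 0; [exact: submodule0 | rewrite mulr0].
    exists (c * v + w); last by rewrite mulrDr; congr (_ + _); apply: mulrCA.
    exact: (@submoduleP _ _ (add_submodule J J')).
  move=> /(spanmod_min (W := Submodule cl)) [].
    move=> _ [_ [_ [y1 _ <-] [_ [y2 _ <-] <-]] [z [[t _ tz] [t' _ t'z]] <-]].
    have tt : a * t = b * t' by rewrite tz.
    (* For [z = a t = b t'], the product [(a y1 + b y2) z] equals [a y1 (b t') + b y2 (a t)]. *)
    exists (y2 * t + y1 * t').
      exists (y2 * t).
        by apply/colonP; exists (y2 * t'); rewrite mulrCA tt mulrCA.
      exists (y1 * t') => //.
      by apply/colon'P; exists (y1 * t); rewrite mulrCA tt mulrCA.
    transitivity (a * y1 * (b * t') + b * y2 * (a * t) : A); last by ring.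
    by rewrite tz t'z; exact: mulrDl.
  by move=> w Jw /(mulfI (mulf_neq0 a_neq0 b_neq0)) ->.
have -> : a * b * (c + d') = b * (a * c) + a * (b * d').
  by rewrite mulrDr !mulrA [b * a]mulrC.
apply: submoduleD; apply: sub_spanmod.
  exists b.
    exists 0; [exact: submodule0|exists b; last by rewrite add0r].
    by exists 1; rewrite ?mulr1.
  exists (a * c) => //; split; [by exists c|by exists d].
exists a.
  exists a; first by exists 1; rewrite ?mulr1.
  by exists 0; [exact: submodule0 | rewrite addr0].
exists (b * d') => //; split; [by exists c'|by exists d'].
Qed.

(** Division by [ab] turns [M / N] into [A / (J + J')], and [coef_extend] shows that [B / J B]
    consists of polynomials modulo those with coefficients in [J + J']. *)
Lemma quotmod_adjoin_tensor :
  isomorphic (restr pi (quotmod JB) : lmodType {poly A})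
    (tensor C (subquot M N) ({poly A}^o : lmodType {poly A})).
Proof.
pose W : lmodType {poly A} := restr pi (quotmod JB).
pose P (m : subquot M N) (w : restr C W) :=
  exists2 u, m = subq M N (a * b * u) & w = qpi JB (i u).
have Mab u : M (a * b * u) by exists u.
have coset_eq0 y : qpi JB y = 0 <-> JB y.
  by rewrite -(linear0 (qpi JB)); split=> [/qpi_eqP|Jy];
    [rewrite subr0|apply: qpi_eq; rewrite subr0].
have JB0 u : JB (i u) <-> N (a * b * u).
  split=> [JBu|/mul_ideal_colon].
    apply/mul_ideal_colon.
    by have := coef_extend (p := u%:P) 0 JBu; rewrite coefC.
  case=> c Jc [d' /colon'P[c' cd'] <-]; rewrite rmorphD.
  apply: submoduleD.
    by apply: sub_spanmod; exists c.
  (* [d'] is [a/b] times [c'], and [c'] lies in [J]. *)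
  have E : a *: c'%:P = b *: d'%:P by rewrite -!mul_polyC -!polyCM cd'.
  have -> : i d' = pi 'X * pi c'%:P by exact: (pi_ratio E).
  by apply: submoduleZ; apply: (extend_colon E).
have [h hP] : exists h : {linear subquot M N -> restr C W},
    forall m w, P m w <-> h m = w.
  apply: linear_of_rel.
  - move=> c _ _ _ _ [u -> ->] [v -> ->]; exists (c * u + v).
      rewrite -subqP //; congr subq.
      by rewrite mulrDr; congr (_ + _); apply: mulrCA.
    rewrite rmorphD rmorphM linearD; congr (_ + _).
    exact: (esym (linearZ_LR (qpi JB) (pi c%:P) (i u))).
  - by move=> m; have [_ [u _ <-] ->] := subq_surj m; exists (qpi JB (i u)), u.
  - by move=> w [u /esym/(subq_eq0 _)/JB0 Ju ->]; apply/coset_eq0/Ju.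
have hE u : h (subq M N (a * b * u)) = qpi JB (i u) by apply/hP; exists u.
have hs n (u : nat -> A) :
    X_sum (h : _ -> W) n (fun k => subq M N (a * b * u k)) =
    qpi JB (pi (\poly_(k < n) u k)).
  rewrite poly_def rmorph_sum linear_sum; apply: eq_bigr => k _.
  rewrite hE -mul_polyC mulrC rmorphM.
  exact: (esym (linearZ_LR (qpi JB) (pi 'X^k) (i (u k)))).
apply: (isomorphic_tensor_poly (h := h)) => [w|n m].
  have [p E] := adjoin_eval_surj (repr (w : quotmod JB)).
  exists (size p), (fun k => subq M N (a * b * p`_k)).
  by rewrite hs -/(poly _ _) coefK E qpiK.
have /choice[u uP] k : exists u, m k = subq M N (a * b * u).
  by have [_ [u _ <-] ->] := subq_surj (m k); exists u.
have -> : m = fun k => subq M N (a * b * u k) by apply/funext.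
rewrite hs => /coset_eq0 JBu k kn.
apply/subq_eq0 => //; apply/mul_ideal_colon.
by have := coef_extend k JBu; rewrite coef_poly kn.
Qed.
End AdjoinIdeals.

(** * Polynomials with a double zero at [a/b] *)

Section CriticalIdeal.
Variable A : idomainType.
Hypothesis A_closed : integrally_closed A.
Variables a b : A.
Hypotheses (a_neq0 : a != 0) (b_neq0 : b != 0).
Local Notation pi := (adjoin_eval a b).
Local Notation cap := (cap_submodule (principal a) (principal b)).
Local Notation M := (cap_submodule (principal (a ^+ 2)) (principal (b ^+ 2))).
Local Notation N := (mul_ideal cap cap).
Local Notation C := (polyC : {rmorphism A -> {poly A}}).
Local Notation I2 := (mul_ideal (kernel pi) (kernel pi)).
Local Notation crit := (critical_ideal pi).

(** [ratios g h k] states that [h = (a/b) g] and [k = (a/b)^2 g]; then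
    [double_factor g h k] is [(X - a/b)^2 g]. *)
Definition ratios (g h k : {poly A}) := a *: g = b *: h /\ a *: h = b *: k.
Definition double_factor (g h k : {poly A}) : {poly A} :=
  'X^2 * g - 2%:R * 'X * h + k.

Lemma ratios_linear (c g h k g' h' k' : {poly A}) :
  ratios g h k -> ratios g' h' k' ->
  ratios (c * g + g') (c * h + h') (c * k + k').
Proof.
move=> [gh hk] [gh' hk']; split; rewrite !scalerDr !scalerAr.
  by rewrite gh gh'.
by rewrite hk hk'.
Qed.

Lemma double_factor_linear (c g h k g' h' k' : {poly A}) :
  double_factor (c * g + g') (c * h + h') (c * k + k') =
  c * double_factor g h k + double_factor g' h' k'.
Proof. by rewrite /double_factor; ring. Qed.

(** Clearing denominators moves [(X - a/b)^2] into [A[X]], where it can be cancelled to recover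
    [g]. *)
Lemma scale_double_factor g h k : ratios g h k ->
  (b ^+ 2)%:P * double_factor g h k = (b%:P * 'X - a%:P) ^+ 2 * g.
Proof.
rewrite /ratios -!mul_polyC => -[gh hk]; rewrite /double_factor polyCM.
transitivity (b%:P ^+ 2 * 'X^2 * g - 2%:R * 'X * b%:P * (b%:P * h) +
  b%:P * (b%:P * k)); first by ring.
rewrite -hk -gh; transitivity (b%:P ^+ 2 * 'X^2 * g -
  2%:R * 'X * b%:P * (a%:P * g) + a%:P * (b%:P * h)); first by ring.
by rewrite -gh; ring.
Qed.

Lemma linear_neq0 : b%:P * 'X - a%:P != 0 :> {poly A}.
Proof.
apply: contra_neq b_neq0 => /(congr1 (fun p : {poly A} => p`_1)).
by rewrite coefB coefMX !coefC /= subr0.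
Qed.

Lemma double_factor_inj g h k g' h' k' : ratios g h k -> ratios g' h' k' ->
  double_factor g h k = double_factor g' h' k' -> g = g'.
Proof.
move=> gr gr' E; apply: (mulfI (expf_neq0 2 linear_neq0)).
by rewrite -(scale_double_factor gr) E scale_double_factor.
Qed.

(** The derivative is [(X - a/b)^2 g' + 2 (X - a/b) g]. The auxiliary [E] covers both values, the
    summand [c] being the second term. *)
Lemma crit_double_factor g h k : ratios g h k -> crit (double_factor g h k).
Proof.
move=> [gh hk]; have [gh' hk'] := (deriv_ratio gh, deriv_ratio hk).
have [Eh Ek] := (pi_ratio b_neq0 gh, pi_ratio b_neq0 hk).
have [Eh' Ek'] := (pi_ratio b_neq0 gh', pi_ratio b_neq0 hk').
have E c (p q r : {poly A}) : pi q = pi 'X * pi p -> pi r = pi 'X * pi q ->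
    pi c = 0 -> pi (double_factor p q r + c) = 0.
  move=> pq qr c0; rewrite /double_factor !rmorphD rmorphN !rmorphM c0 qr pq.
  by ring.
split; first by have := E 0 _ _ _ Eh Ek (rmorph0 _); rewrite addr0.
have -> : (double_factor g h k)^`() =
    double_factor g^`() h^`() k^`() + 2%:R * ('X * g - h).
  by rewrite /double_factor !derivE; ring.
apply: E => //; rewrite rmorphM rmorphB rmorphM Eh subrr; exact: mulr0.
Qed.

(** If [p = X q - r], then [p'(a/b) = q(a/b)], so [q] and [r] are again in the kernel and factor as
    [X g - h] and [X g' - k]. From [r = (a/b) q] one gets [h = g']. *)
Lemma double_factorP p : crit p ->
  exists g h k, ratios g h k /\ p = double_factor g h k.
Proof.
move=> [p0]; have [q [r [pE qr]]] := kernel_factor A_closed b_neq0 p0.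
rewrite pE pi_deriv // => q0.
have r0 : pi r = 0 by rewrite (pi_ratio b_neq0 qr) q0 mulr0.
have [g [h [qE gh]]] := kernel_factor A_closed b_neq0 q0.
have [g' [k [rE hk]]] := kernel_factor A_closed b_neq0 r0.
have bq : b%:P * q = (b%:P * 'X - a%:P) * g.
  by rewrite qE mulrBr mulrBl !mul_polyC -gh -!mul_polyC mulrA.
have br : b%:P * r = (b%:P * 'X - a%:P) * g'.
  by rewrite rE mulrBr mulrBl !mul_polyC -hk -!mul_polyC mulrA.
have E : b *: h = b *: g'.
  rewrite -gh -!mul_polyC; apply: (mulfI linear_neq0).
  transitivity (b%:P * (a%:P * q)); first by rewrite mulrCA -bq mulrCA.
  by rewrite [RHS]mulrCA -br !mul_polyC qr.
have {}E : h = g'.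
  by apply: (mulfI (_ : b%:P != 0)); rewrite ?polyC_eq0 // !mul_polyC.
rewrite -E in rE hk; exists g, h, k; split=> //.
by rewrite rE qE /double_factor; ring.
Qed.

(** A product of [(X - a/b) q] and [(X - a/b) q'] has [g = q q'], and
    [a^2 q_l q'_m = (a q_l)(a q'_m)] is a product of two elements of [cap]. *)
Lemma kernel2_double_factor p : I2 p -> exists g h k,
  [/\ ratios g h k, p = double_factor g h k & forall j, N (a ^+ 2 * g`_j)].
Proof.
pose P (p : {poly A}) := exists g h k,
  [/\ ratios g h k, p = double_factor g h k & forall j, N (a ^+ 2 * g`_j)].
have cl : P 0 /\ forall (c u v : {poly A}), P u -> P v -> P (c * u + v).
  split=> [|c _ _ [g [h [k [gr -> gN]]]] [g' [h' [k' [gr' -> gN']]]]].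
    exists 0, 0, 0; split; first by split; rewrite !scaler0.
      by rewrite /double_factor !mulr0 subr0 addr0.
    by move=> j; rewrite coef0 mulr0; apply: submodule0.
  exists (c * g + g'), (c * h + h'), (c * k + k'); split.
  - exact: ratios_linear.
  - by rewrite double_factor_linear.
  - move=> j; rewrite coefD mulrDr; apply: submoduleD => //.
    rewrite coefM mulr_sumr; apply: submodule_sum => l _.
    by rewrite mulrCA; apply: submoduleZ.
move=> I2p; have : @Submodule _ ({poly A}^o) P cl p; last by [].
apply: spanmod_min I2p => _ [p0 p00 [p1 p10 <-]].
have [q [r [-> qr]]] := kernel_factor A_closed b_neq0 p00.
have [q' [r' [-> qr']]] := kernel_factor A_closed b_neq0 p10.
exists (q * q'), (q * r'), (r * r'); split.
- by split; [rewrite !scalerAr qr' | rewrite !scalerAl qr].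
- have E : q * r' = r * q'.
    apply: (mulfI (_ : b%:P != 0)); rewrite ?polyC_eq0 //.
    transitivity (b%:P * r' * q); first by ring.
    rewrite mul_polyC -qr' -mul_polyC.
    transitivity (a%:P * q * q'); first by ring.
    by rewrite mul_polyC qr -mul_polyC mulrA.
  rewrite /double_factor; transitivity ('X^2 * (q * q') - 'X * (q * r') -
    'X * (r * q') + r * r'); first by ring.
  by rewrite -E; ring.
- move=> j; rewrite coefM mulr_sumr; apply: submodule_sum => l _.
  have cap_coef (s s' : {poly A}) m : a *: s = b *: s' -> cap (a * s`_m).
    move=> E; split; first by exists s`_m.
    by exists s'`_m => //; rewrite -!coefZ E.
  rewrite expr2 mulrACA; apply: sub_spanmod.
  exists (a * q`_l); first exact: cap_coef qr.
  by exists (a * q'`_(j - l)); first exact: cap_coef qr'.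
Qed.

(** For a generator [(a t)(a r)] of [N], with [a t = b t'] and [a r = b r'], the double factor is
    [(X t - t')(X r - r')]. Cancelling [a^2] and [b] shows that [a^2 u] determines [u], [d] and
    [v]. *)
Lemma double_factor_kernel2 u d v : a * u = b * d -> a * d = b * v ->
  N (a ^+ 2 * u) -> I2 (double_factor u%:P d%:P v%:P).
Proof.
pose P (m : A) := exists u d v, [/\ a * u = b * d, a * d = b * v,
  m = a ^+ 2 * u & I2 (double_factor u%:P d%:P v%:P)].
have cl : P 0 /\ forall (c m m' : A), P m -> P m' -> P (c * m + m').
  split=> [|c _ _ [u0 [d0 [v0 [ud dv -> I2u]]]]
      [u1 [d1 [v1 [ud1 dv1 -> I2u1]]]]].
    exists 0, 0, 0; split; rewrite ?mulr0 //.
    by rewrite /double_factor !mulr0 subr0 addr0; apply: submodule0.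
  exists (c * u0 + u1), (c * d0 + d1), (c * v0 + v1); split.
  - by rewrite !mulrDr mulrCA ud ud1 mulrCA.
  - by rewrite !mulrDr mulrCA dv dv1 mulrCA.
  - by rewrite mulrDr mulrCA.
  - by rewrite !polyCD !polyCM double_factor_linear; apply: submoduleP.
move=> ud dv Nu; have : @Submodule _ A^o P cl (a ^+ 2 * u).
  apply: spanmod_min Nu => _
    [_ [[t _ <-] [t' _ tt']] [_ [[r _ <-] [r' _ rr']] <-]].
  exists (t * r), (t * r'), (t' * r').
  have ker s s' : b * s' = a * s -> kernel pi ('X * s%:P - s'%:P).
    move=> E; rewrite /= rmorphB rmorphM; apply/eqP; rewrite subr_eq0 eq_sym.
    by apply/eqP/(pi_ratio b_neq0); rewrite -!mul_polyC -!polyCM E.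
  split.
  - by rewrite mulrCA -rr' mulrCA.
  - by rewrite mulrA -tt' mulrA.
  - by ring.
  - have E : t * r' = t' * r.
      apply: (mulfI b_neq0); transitivity (t * (b * r')); first by ring.
      rewrite rr'; transitivity (a * t * r); first by ring.
      by rewrite -tt'; ring.
    have -> : double_factor (t * r)%:P (t * r')%:P (t' * r')%:P =
        ('X * t%:P - t'%:P) * ('X * r%:P - r'%:P).
      rewrite /double_factor; transitivity ('X^2 * (t * r)%:P -
        'X * (t * r')%:P - 'X * (t' * r)%:P + (t' * r')%:P); last first.
        by rewrite !polyCM; ring.
      by rewrite -E; ring.
    by apply: mul_kernel; apply: ker.
move=> [u' [d' [v' [ud' dv']]]].
move=> /(mulfI (expf_neq0 2 a_neq0)) uu; rewrite -uu in ud' *.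
have dd : d = d' by apply: (mulfI b_neq0); rewrite -ud ud'.
have vv : v = v' by apply: (mulfI b_neq0); rewrite -dv -dv' dd.
by rewrite dd vv.
Qed.

(** The map sends [a^2 u] to the class of [(X - a/b)^2 u]; [double_factorP] gives surjectivity of
    the induced sums, and [kernel2_double_factor] injectivity. *)
Lemma critical_tensor :
  isomorphic (subquot crit I2 : lmodType {poly A})
    (tensor C (subquot M N) ({poly A}^o : lmodType {poly A})).
Proof.
pose W : lmodType {poly A} := subquot crit I2.
pose ratio u d v := a * u = b * d /\ a * d = b * v.
pose cl u d v := subq crit I2 (double_factor u%:P d%:P v%:P).
have ratioC u d v : ratio u d v -> ratios u%:P d%:P v%:P.
  by move=> [ud dv]; split; rewrite -!mul_polyC -!polyCM ?ud ?dv.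
(* Integral closedness provides the middle term: if [u] and [u (a/b)^2] are in [A], so is
   [u (a/b)]. *)
have ratio_ex m : M m -> exists u d v, ratio u d v /\ m = a ^+ 2 * u.
  move=> [[u _ <-] [v _ E]].
  have [d [ud dv]] := square_ratio A_closed b_neq0 (esym E).
  by exists u, d, v.
have MP u d v : ratio u d v -> M (a ^+ 2 * u).
  move=> [ud dv]; split; first by exists u.
  by exists v => //; rewrite !expr2 -!mulrA -dv ud mulrCA.
have cr u d v : ratio u d v -> crit (double_factor u%:P d%:P v%:P).
  by move=> /ratioC; apply: crit_double_factor.
pose P (m : subquot M N) (w : restr C W) := exists u d v,
  [/\ ratio u d v, m = subq M N (a ^+ 2 * u) & w = cl u d v].
have [h hP] : exists h : {linear subquot M N -> restr C W},
    forall m w, P m w <-> h m = w.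
  apply: linear_of_rel.
  - move=> c _ _ _ _ [u [d [v [r -> ->]]]] [u' [d' [v' [r' -> ->]]]].
    exists (c * u + u'), (c * d + d'), (c * v + v'); split.
    + have [[ud dv] [ud' dv']] := (r, r').
      by split; rewrite !mulrDr ![_ * (c * _)]mulrCA ?ud ?ud' ?dv ?dv'.
    + rewrite -subqP; [|exact: MP r|exact: MP r'].
      by congr subq; rewrite mulrDr mulrCA.
    + rewrite /cl !polyCD !polyCM double_factor_linear.
      exact: (esym (subqP _ _ (cr _ _ _ r) (cr _ _ _ r'))).
  - move=> m; have [_ /ratio_ex[u [d [v [r ->]]]] ->] := subq_surj m.
    by exists (cl u d v), u, d, v.
  - move=> w [u [d [v [r /esym/(subq_eq0 _ (MP _ _ _ r)) Nu ->]]]].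
    apply/(subq_eq0 _ (cr _ _ _ r)); have [ud dv] := r.
    exact: double_factor_kernel2.
have hE u d v : ratio u d v -> h (subq M N (a ^+ 2 * u)) = cl u d v.
  by move=> r; apply/hP; exists u, d, v.
have polyS n (u : nat -> A) :
    \poly_(k < n.+1) u k = 'X^n * (u n)%:P + \poly_(k < n) u k.
  by rewrite !poly_def big_ord_recr addrC -mul_polyC mulrC.
have poly0 (u : nat -> A) : \poly_(k < 0) u k = 0 by rewrite poly_def big_ord0.
have hs n (u d v : nat -> A) : (forall k, ratio (u k) (d k) (v k)) ->
    ratios (\poly_(k < n) u k) (\poly_(k < n) d k) (\poly_(k < n) v k) /\
    X_sum (h : _ -> W) n (fun k => subq M N (a ^+ 2 * u k)) =
    subq crit I2 (double_factor (\poly_(k < n) u k) (\poly_(k < n) d k)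
      (\poly_(k < n) v k)).
  move=> r; elim: n => [|n [IHr IHs]].
    rewrite !poly0 /X_sum big_ord0 /double_factor !mulr0 subr0 addr0.
    split; first by split; rewrite !scaler0.
    apply/esym/(@subq_eq0 _ _ crit); exact: submodule0.
  rewrite !polyS; split; first by apply: ratios_linear => //; apply: ratioC.
  rewrite double_factor_linear; have := crit_double_factor IHr.
  move=> /(subqP I2 'X^n (cr _ _ _ (r n))) E; refine (etrans _ (esym E)).
  by rewrite -IHs /X_sum big_ord_recr addrC (hE _ _ _ (r n)).
apply: (isomorphic_tensor_poly (h := h)) => [w|n m].
  have [p /double_factorP[g [g' [g'' [[gg' gg''] ->]]]] ->] := subq_surj w.
  (* A common bound for three sizes, as [hs] truncates the three polynomials at the same [n]. *)
  pose n := (size g + size g' + size g'')%N.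
  have wide (q : {poly A}) : (size q <= n)%N -> \poly_(k < n) q`_k = q.
    move=> qn; apply/polyP => k; rewrite coef_poly; case: ltnP => // nk.
    by rewrite nth_default // (leq_trans qn).
  exists n, (fun k => subq M N (a ^+ 2 * g`_k)).
  have [|_ ->] := hs n (fun k => g`_k) (fun k => g'`_k) (fun k => g''`_k).
    by move=> k; split; rewrite -!coefZ ?gg' ?gg''.
  by rewrite !wide //; [exact: leq_addl|rewrite /n addnAC leq_addl|
    rewrite /n -addnA leq_addr].
have /choice[t tP] k : exists t : A * A * A,
    ratio t.1.1 t.1.2 t.2 /\ m k = subq M N (a ^+ 2 * t.1.1).
  have [_ /ratio_ex[u [d [v [r ->]]]] ->] := subq_surj (m k).
  by exists (u, d, v).
have -> : m = fun k => subq M N (a ^+ 2 * (t k).1.1).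
  by apply/funext => k; case: (tP k).
have [r ->] := hs n _ _ _ (fun k => (tP k).1).
(* Membership in [I2] yields some [g] with all [a^2 g_j] in [N]; [double_factor_inj] identifies it
   with the given polynomial. *)
move=> /(subq_eq0 _ (crit_double_factor r)) /kernel2_double_factor.
move=> [g [g' [g'' [gr E gN]]]] k kn.
apply/(subq_eq0 _ (MP _ _ _ (tP k).1)).
by have := gN k; rewrite -(double_factor_inj r gr E) coef_poly kn.
Qed.

End CriticalIdeal.

Unset Implicit Arguments.

Theorem theorem1p2 (A : idomainType) (A_closed : integrally_closed A)
    (a b : A) (a_neq0 : a != 0) (b_neq0 : b != 0) :
  let B : comNzRingType := adjoin a b in
  let R : comNzRingType := {poly A} in
  let pi : {rmorphism R -> B} := adjoin_eval a b in
  let AtoB : {rmorphism A -> B} := adjoin_map a b in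
  let AtoR : {rmorphism A -> R} := polyC in
  let aA : ideal A := principal a in
  let bA : ideal A := principal b in
  (isomorphic
     (restr pi (kahler AtoB) : lmodType R)
     (restr pi (quotmod (extend_ideal AtoB (colon bA a))) : lmodType R) /\
   isomorphic
     (restr pi (quotmod (extend_ideal AtoB (colon bA a))) : lmodType R)
     (tensor AtoR
       (subquot (principal (a * b))
         (mul_ideal (add_submodule aA bA) (cap_submodule aA bA)))
       (R^o : lmodType R))) /\
  isomorphic
    (restr pi (andre_quillen AtoB (B^o : lmodType B) 1) : lmodType R)
    (tensor AtoR
       (subquot (cap_submodule (principal (a ^+ 2)) (principal (b ^+ 2)))
         (mul_ideal (cap_submodule aA bA) (cap_submodule aA bA)))
       (R^o : lmodType R)).
Proof.
split; first split.
- exact: kahler_adjoin.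
- exact: quotmod_adjoin_tensor.
apply: isomorphic_trans (critical_tensor A_closed a_neq0 b_neq0).
apply: andre_quillen1 => //; exact: adjoin_eval_surj.
Qed.
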